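(* Let $\gamma\in(0,1)$, $\delta\in(0,1)$, $\lambda>0$, $\eta=1+RS$, $\alpha=\frac{3\eta}{2}$, and let $(\theta_t)$, $(A_t)$ be generated by the discounted online mirror descent recursion described in the context. Define the Gaussian distribution $\Pi_t:=\mathcal N(\theta_t,\alpha A_t^{-1})$ and the mix loss $$m_t(\Pi_t):=-\log\mathbb E_{\theta\sim\Pi_t}\left[e^{-\ell_t(\theta)}\right].$$ Then, for any fixed $t\ge2$, with probability at least $1-\delta$, $$\sum_{s=1}^{t-1}\gamma^{t-1-s}\left(\ell_s(\theta_s^\star)-m_s(\Pi_s)\right)\le\log\frac1\delta .$$
   Context: Notation: $\|x\|_M:=\sqrt{x^\top Mx}$ for positive semidefinite $M$; $I_d$ is the identity. In $\mathbb E_{\theta\sim\Pi_t}$ only $\theta$ is averaged, with $\theta_t,A_t,x_t,r_t$ held fixed. Nonstationary generalized linear bandit. Fix $d\ge1$, $R,S>0$. At each round $t=1,2,\dots$ a learner observes a set $\mathcal X_t\subset\mathbb R^d$, chooses $x_t\in\mathcal X_t$ (based on the past), and receives a reward $r_t$. There is an unknown parameter sequence $(\theta_t^\star)_{t\ge1}$ in $\mathbb R^d$, fixed independently of the reward noise (exogenous). Let $p(r\mid z)=\exp\left(\frac{rz-m(z)}{g(\tau)}+h(r,\tau)\right)$, a probability density in $r$ (with respect to a fixed reference measure) for every $z\in\mathbb R$, where $m:\mathbb R\to\mathbb R$ is convex and three times continuously differentiable and $g(\tau)>0$ is a known constant. Put $\mu:=m'$. With $\widetilde{\mathcal F}_t:=\sigma(x_1,r_1,\dots,x_{t-1},r_{t-1},x_t)\vee\sigma(\theta_s^\star:s\ge1)$,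 the conditional law of $r_t$ given $\widetilde{\mathcal F}_t$ has density $p(\cdot\mid x_t^\top\theta_t^\star)$. Standing bounds: $\theta_t^\star\in\Theta:=\{\theta\in\mathbb R^d:\|\theta\|_2\le S\}$, $\|x\|_2\le1$ for $x\in\mathcal X_t$, $r_t\in[0,R]$ a.s. Discounted online mirror descent. Loss: $\ell_t(\theta):=\frac{m(x_t^\top\theta)-r_tx_t^\top\theta}{g(\tau)}$. Start from $\theta_1\in\Theta$, $H_1=\lambda I_d$. For $t\ge1$: $A_t:=\gamma H_t+(1-\gamma)\lambda I_d$, $$\widetilde\ell_t(\theta):=\ell_t(\theta_t)+\langle\nabla\ell_t(\theta_t),\theta-\theta_t\rangle+\tfrac12\|\theta-\theta_t\|^2_{\nabla^2\ell_t(\theta_t)},$$ $$\theta_{t+1}\in\arg\min_{\theta\in\Theta}\left\{\widetilde\ell_t(\theta)+\frac1{2\eta}\|\theta-\theta_t\|_{A_t}^2\right\},\qquad H_{t+1}:=A_t+\nabla^2\ell_t(\theta_{t+1}).$$ In particular $\theta_t$ and $A_t$ are functions of $x_1,r_1,\dots,x_{t-1},r_{t-1}$ (and the initialization). *)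

(* Defs.v *)
From HB Require Import structures.
From mathcomp Require Import all_boot all_order all_algebra.
From mathcomp Require Import all_classical all_reals all_analysis.

Set Implicit Arguments.
Unset Strict Implicit.
Unset Printing Implicit Defensive.

Import Order.TTheory GRing.Theory Num.Theory.
Import numFieldNormedType.Exports.

Local Open Scope classical_set_scope.
Local Open Scope ring_scope.

(* The sigma-algebra on matrices generated by the entries; for 'cV[R]_n it is
   the Borel sigma-algebra of R^n. *)
Definition mx_display : measure_display -> measure_display.
Proof. exact. Qed.

Section measurable_matrix.
Context {disp : measure_display} {T : measurableType disp} {p q : nat}.

Definition mx_measurable : set (set 'M[T]_(p, q)) :=
  <<s \bigcup_(ij in [set: 'I_p * 'I_q])
        preimage_set_system setT (fun M : 'M[T]_(p, q) => M ij.1 ij.2)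
          measurable >>.

Let mx_measurable0 : mx_measurable set0.
Proof. exact: sigma_algebra0. Qed.

Let mx_measurableC A : mx_measurable A -> mx_measurable (~` A).
Proof. exact: sigma_algebraC. Qed.

Let mx_measurable_bigcup (F : (set 'M[T]_(p, q))^nat) :
  (forall i, mx_measurable (F i)) -> mx_measurable (\bigcup_i F i).
Proof. exact: sigma_algebra_bigcup. Qed.

HB.instance Definition _ := @isMeasurable.Build (mx_display disp)
  'M[T]_(p, q) mx_measurable mx_measurable0 mx_measurableC mx_measurable_bigcup.

End measurable_matrix.

Section euclidean.
Context {R : realType} {d : nat}.
Implicit Types (u v : 'cV[R]_d) (M : 'M[R]_d).

Definition dotv u v : R := (u^T *m v) 0 0.

(* The norm `|v| of the library on matrices is the sup norm. *)
Definition norm2 v : R := Num.sqrt (dotv v v).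

Definition normM M v : R := Num.sqrt (dotv v (M *m v)).

Definition ball2 (S : R) : set 'cV[R]_d := [set v | norm2 v <= S].

Definition grad (f : 'cV[R]_d -> R) v : 'cV[R]_d :=
  \col_i 'D_(delta_mx i 0) f v.

Definition hess (f : 'cV[R]_d -> R) v : 'M[R]_d :=
  \matrix_(i, j) 'D_(delta_mx i 0) (fun u => 'D_(delta_mx j 0) f u) v.

Definition is_argmin (D : set 'cV[R]_d) (f : 'cV[R]_d -> R) v : Prop :=
  D v /\ forall u, D u -> f v <= f u.

End euclidean.

(* Lebesgue measure on R^n, as an iterated product; R^0 is a point. *)
Fixpoint lebesgue_cV {R : realType} (n : nat) : set 'cV[R]_n -> \bar R :=
  match n with
  | 0%N => dirac (0 : 'cV[R]_0)
  | k.+1 => pushforward (lebesgue_measure \x lebesgue_cV (n := k))%E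
              (fun p : R * 'cV[R]_k => (col_mx p.1%:M p.2 : 'cV[R]_(1 + k)))
  end.

Section gaussian.
Context {R : realType} {d : nat}.
Variables (c : 'cV[R]_d) (Sigma : 'M[R]_d).

(* The nondegenerate case: Sigma symmetric positive definite. *)
Definition gaussian_pdf (v : 'cV[R]_d) : R :=
  (Num.sqrt ((2 * pi) ^+ d * \det Sigma))^-1
  * expR (- (dotv (v - c) (invmx Sigma *m (v - c)) / 2)).

Definition gaussian_prob (B : set 'cV[R]_d) : \bar R :=
  (\int[lebesgue_cV (n := d)]_(v in B) (gaussian_pdf v)%:E)%E.

End gaussian.

(* The mix loss of the law Pi; the integral is positive and finite when Pi is
   Gaussian and l is a convex function of a linear form of the parameter. *)
Definition mix_loss {R : realType} {d : nat} (Pi : set 'cV[R]_d -> \bar R)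
    (l : 'cV[R]_d -> R) : R :=
  - ln (fine (\int[Pi]_v (expR (- l v))%:E)%E).

Definition glm_pdf {R : realType} (m g : R -> R) (h : R -> R -> R) (tau : R)
    (z r : R) : R :=
  expR ((r * z - m z) / g tau + h r tau).

Definition glm_loss {R : realType} {d : nat} (m g : R -> R) (tau : R)
    (x : 'cV[R]_d) (r : R) (theta : 'cV[R]_d) : R :=
  (m (dotv x theta) - r * dotv x theta) / g tau.

Definition C3 {R : realType} (m : R -> R) : Prop :=
  (forall k z, (k < 3)%N -> derivable (derive1n k m) z 1) /\
  continuous (derive1n 3 m).

Definition taylor2 {R : realType} {d : nat} (l : 'cV[R]_d -> R)
    (v u : 'cV[R]_d) : R :=
  l v + dotv (grad l v) (u - v) + 2^-1 * normM (hess l v) (u - v) ^+ 2.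

(* One trajectory of the recursion, for given losses l_1, l_2, ...; the values
   at index 0 are irrelevant. *)
Definition discounted_omd {R : realType} {d : nat}
    (S lambda gamma eta : R) (theta1 : 'cV[R]_d) (l : nat -> 'cV[R]_d -> R)
    (theta : nat -> 'cV[R]_d) (H A : nat -> 'M[R]_d) : Prop :=
  [/\ theta 1%N = theta1, H 1%N = lambda%:M &
   forall t, (1 <= t)%N ->
    [/\ A t = gamma *: H t + (1 - gamma) *: lambda%:M,
        is_argmin (ball2 S)
          (fun v => taylor2 (l t) (theta t) v
                    + (2 * eta)^-1 * normM (A t) (v - theta t) ^+ 2)
          (theta t.+1) &
        H t.+1 = A t + hess (l t) (theta t.+1)]].

Section conditioning.
Context {R : realType} {disp : measure_display} {Omega : measurableType disp}.

(* sigma(x_1, r_1, ..., x_{t-1}, r_{t-1}, x_t) \/ sigma(thetastar_s : s >= 1) *)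
Definition history {d : nat} (x : nat -> Omega -> 'cV[R]_d)
    (r : nat -> Omega -> R) (thetastar : nat -> Omega -> 'cV[R]_d) (t : nat) :
    set (set Omega) :=
  <<s \bigcup_(s in [set s | (1 <= s <= t)%N])
        preimage_set_system setT (x s) measurable
      `|` \bigcup_(s in [set s | (1 <= s < t)%N])
        preimage_set_system setT (r s) measurable
      `|` \bigcup_(s in [set s | (1 <= s)%N])
        preimage_set_system setT (thetastar s) measurable >>.

(* The conditional law of Y given the sub-sigma-algebra G has density f w
   with respect to nu. *)
Definition has_cond_density (P : probability Omega R) (G : set (set Omega))
    (Y : Omega -> R) (nu : {measure set R -> \bar R}) (f : Omega -> R -> R) :
    Prop :=
  forall E B, G E -> measurable B ->
    P (E `&` Y @^-1` B) = (\int[P]_(w in E) \int[nu]_(y in B) (f w y)%:E)%E.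

End conditioning.

(* Main.v *)
(** Set [Z_s := l_s(thetastar_s) - m_s(Pi_s)]. Then [exp Z_s] is the likelihood
    ratio between the [Pi_s]-mixture of the densities p(. | x_s . theta) and the
    true density p(. | x_s . thetastar_s); since [Pi_s] is a function of the past,
    Tonelli gives [E (exp Z_s | past) <= 1]. The discounted sums satisfy
    [W_(t+1) = gamma W_t + Z_t], hence
    [E exp W_(t+1) <= E exp (gamma W_t) <= gamma E exp W_t + 1 - gamma]
    by convexity of [exp], so [E exp W_t <= 1] for all t, and Markov's inequality
    concludes. The iterate [theta_(t+1)] is a measurable function of the past
    because it minimizes a strongly convex quadratic over a ball. *)

Require Import Defs.
From HB Require Import structures.
From mathcomp Require Import all_boot all_order all_algebra.
From mathcomp Require Import ring lra.
From mathcomp Require Import all_classical all_reals all_analysis.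
From mathcomp Require Import measurable_realfun.

Set Implicit Arguments.
Unset Strict Implicit.
Unset Printing Implicit Defensive.

Import Order.TTheory GRing.Theory Num.Theory.
Import numFieldNormedType.Exports.

Local Open Scope classical_set_scope.
Local Open Scope ring_scope.

(** * Measures with a density, and the joint law of a reward and the past *)

(** Three obstacles shape the development. Conditioning is available only as the identity
    [has_cond_density] on events, so no conditional expectation is formed: the past becomes a
    measurable space of its own, [Omega] with a coarser sigma-algebra, and Tonelli is applied on its
    product with the reward axis. The measurability lemmas are therefore stated over an arbitrary
    measurable space, to serve for [Omega] and for the history alike. Next, the law [Pi_s] moves
    with the past, whereas Tonelli wants a fixed base measure: Gaussian laws are turned into
    densities against Lebesgue measure, expressed through the precision matrix [alpha^-1 A_s], and
    their total mass is computed by recursion on the dimension with Schur complements. Finally,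
    Tonelli also asks for a sigma-finite reference measure of the rewards; this follows from the
    existence of one strictly positive density of integral 1. *)

Section density.
Local Open Scope ereal_scope.
Context d (T : measurableType d) (R : realType).
Variables (mu : {measure set T -> \bar R}) (f : T -> R).
Hypotheses (mf : measurable_fun [set: T] f) (f0 : forall x, (0 <= f x)%R).

Let mEf : measurable_fun [set: T] (EFin \o f).
Proof. exact/measurable_EFinP. Qed.

Let Ef0 x : 0 <= (EFin \o f) x.
Proof. by rewrite lee_fin. Qed.

Import HBNNSimple.

(** The equation covers non-measurable sets too, so that a set function given by an integral
    formula, such as [gaussian_prob], can be replaced by [m] through functional extensionality. *)
Lemma exists_density_measure :
  exists m : {measure set T -> \bar R}, forall A, m A = \int[mu]_(x in A) (f x)%:E.
Proof.
pose m A := \int[mu]_(x in A) (f x)%:E.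
have m0 : m set0 = 0 by exact: integral_set0.
have m_ge0 A : 0 <= m A by apply: integral_ge0 => x _; rewrite lee_fin.
pose mM : isMeasure d T R m := isMeasure.Build _ _ _ m m0 m_ge0
  (semi_sigma_additive_nng_induced mEf Ef0).
by exists (HB.pack_for {measure set T -> \bar R} m mM).
Qed.

(** Monotone convergence along simple approximations of [phi] leaves only simple functions, for
    which the hypothesis on [m] turns both sides into the same finite sum over values. *)
Lemma ge0_integral_density (m : {measure set T -> \bar R}) (phi : T -> \bar R) :
  (forall A, measurable A -> m A = \int[mu]_(x in A) (f x)%:E) ->
  measurable_fun [set: T] phi -> (forall x, 0 <= phi x) ->
  \int[m]_x phi x = \int[mu]_x (phi x * (f x)%:E).
Proof.
move=> mE mphi phi0.
pose h := nnsfun_approx measurableT mphi.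
have hcvg x : (h n x)%:E @[n --> \oo] --> phi x.
  by apply: cvg_nnsfun_approx => // y _; exact: phi0.
have hnd x : {homo h^~ x : a b / (a <= b)%N >-> (a <= b)%R}.
  by move=> a b ab; exact/lefP/nd_nnsfun_approx.
have -> : \int[m]_x phi x = limn (fun n => \int[m]_x (h n x)%:E).
  rewrite -monotone_convergence//.
  - by apply: eq_integral => x _; apply/esym/cvg_lim => //; exact: hcvg.
  - by move=> n; exact/measurable_EFinP.
  - by move=> n x _; rewrite lee_fin.
  - by move=> x _ a b ab; rewrite lee_fin; exact: hnd.
have -> : \int[mu]_x (phi x * (f x)%:E) = limn (fun n => \int[mu]_x ((h n x)%:E * (f x)%:E)).
  rewrite -monotone_convergence//.
  - apply: eq_integral => x _; apply/esym/cvg_lim => //.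
    exact: cvgeZr.
  - by move=> n; apply: emeasurable_funM => //; exact/measurable_EFinP.
  - by move=> n x _; rewrite mule_ge0// lee_fin.
  - by move=> x _ a b ab; apply: lee_wpmul2r; rewrite lee_fin//; exact: hnd.
congr (limn _); apply/funext => n.
have mh r : measurable (h n @^-1` [set r]) by exact: measurable_sfunP.
transitivity (\sum_(k \in range (h n)) (k%:E * \int[mu]_(x in h n @^-1` [set k]) (f x)%:E)).
  under eq_integral do rewrite fimfunE -fsumEFin//.
  rewrite ge0_integral_fsum//; last 2 first.
  - by move=> y; exact/measurable_EFinP/measurable_funM.
  - by move=> y x _; rewrite nnfun_muleindic_ge0.
  by apply: eq_fsbigr => r _; rewrite integralZl_indic_nnsfun// integral_indic//= setIT mE.
transitivity (\sum_(k \in range (h n))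
    \int[mu]_x ((k * \1_(h n @^-1` [set k]) x)%:E * (f x)%:E)).
  apply: eq_fsbigr => r; rewrite inE => -[z _ <-].
  rewrite (integral_mkcond (h n @^-1` _)) -ge0_integralZl//; last 3 first.
  - apply/(measurable_restrictT _ _).1 => //; exact: measurable_funTS.
  - by move=> x _; rewrite patchE; case: ifPn => // _; rewrite lee_fin.
  - by rewrite lee_fin.
  apply: eq_integral => x _; rewrite patchE indicE; case: ifPn => _ //=.
    by rewrite mulr1.
  by rewrite mulr0 mul0e mule0.
rewrite -ge0_integral_fsum//.
- apply: eq_integral => x _; rewrite -ge0_mule_fsuml.
    by rewrite fsumEFin// -fimfunE.
  by move=> k; rewrite nnfun_muleindic_ge0.
- by move=> k; apply: emeasurable_funM => //; exact/measurable_EFinP/measurable_funM.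
- move=> k x _; apply: mule_ge0; last by rewrite lee_fin.
  exact: nnfun_muleindic_ge0.
Qed.

End density.

(** * Disintegration of the joint law of the past and a reward *)

Section conditional_density.
Local Open Scope ereal_scope.
Context {R : realType} {disp : measure_display} {Omega : measurableType disp}.
Variables (P : probability Omega R) (G0 : set (set Omega)).
Hypothesis G0m : <<s G0 >> `<=` (measurable : set (set Omega)).
Variables (Y : Omega -> R) (nu : {sigma_finite_measure set R -> \bar R}).
Hypothesis mY : measurable_fun [set: Omega] Y.
Local Notation GT := (g_sigma_algebraType G0).
Variable f : Omega -> R -> R.
Hypotheses (mf : measurable_fun [set: GT * R] (fun p : GT * R => f p.1 p.2))
  (f0 : forall w y, (0 <= f w y)%R) (fY : has_cond_density P <<s G0 >> Y nu f).

Lemma measurable_id_sub : measurable_fun [set: Omega] (id : Omega -> GT).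
Proof. by move=> _ B mB; rewrite setTI preimage_id; exact: G0m. Qed.

(** [fY] determines the joint law of the past and [Y] on rectangles. These form a pi-system
    generating the product sigma-algebra, and the joint law is finite, so it has density [f] with
    respect to the product of [P] on the past and [nu]. Tonelli then gives the iterated integral. *)
Lemma integral_cond_density (phi : GT * R -> \bar R) :
  measurable_fun [set: GT * R] phi -> (forall p, 0 <= phi p) ->
  \int[P]_w phi (w : GT, Y w) =
  \int[P]_w \int[nu]_y (phi (w : GT, y) * (f w y)%:E).
Proof.
move=> mphi phi0.
(* The restriction of [P] to the past, obtained as an image under the identity. The product with
   [nu] is built over [GT] because [f] and [phi] are jointly measurable for that sigma-algebra. *)
pose PG0 : {measure set GT -> \bar R} :=
  measure_function_pushforward__canonical__measure_function_Measure P
    measurable_id_sub.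
have PG0T : PG0 setT = 1 by rewrite /PG0 /= /pushforward preimage_setT probability_setT.
pose PG : probability GT R := HB.pack_for (probability GT R) (PG0 : set _ -> \bar R)
  (Measure.class PG0) (Measure_isProbability.Build _ _ _ PG0 PG0T).
have PGE (g : GT -> \bar R) : measurable_fun [set: GT] g -> (forall w, 0 <= g w) ->
    \int[PG]_w g w = \int[P]_w g (w : GT).
  move=> mg g0.
  by have := @ge0_integral_pushforward _ _ _ _ R _ measurable_id_sub P setT g
    measurableT mg (fun y _ => g0 y); rewrite preimage_setT.
have mpair : measurable_fun [set: Omega] (fun w => (w : GT, Y w)).
  by apply: measurable_fun_pair => //; exact: measurable_id_sub.
pose m1 : {measure set (GT * R) -> \bar R} :=
  measure_function_pushforward__canonical__measure_function_Measure P mpair.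
pose mu := (PG \x nu)%E.
have [m2 m2E] := exists_density_measure mu mf (fun p => f0 p.1 p.2).
have rect E B : measurable E -> measurable B -> m1 (E `*` B) = m2 (E `*` B).
  move=> mE mB; rewrite m2E.
  have -> : m1 (E `*` B) = P ((E : set Omega) `&` Y @^-1` B) by [].
  rewrite fY//.
  pose g (p : GT * R) := ((fun p => (f p.1 p.2)%:E) \_ (E `*` B)) p.
  have mg : measurable_fun [set: GT * R] g.
    apply/(measurable_restrictT _ _).1; first exact: measurableX.
    by apply: measurable_funTS; exact/measurable_EFinP.
  have g0 p : 0 <= g p.
    by rewrite /g patchE; case: ifPn => // _; rewrite lee_fin.
  rewrite [RHS]integral_mkcond.
  rewrite (@fubini_tonelli1 _ _ _ _ _ PG nu g)// PGE; last 2 first.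
  - exact: (measurable_fun_fubini_tonelli_F g).
  - by move=> w; apply: integral_ge0.
  rewrite integral_mkcond; apply: eq_integral => w _.
  rewrite /fubini_F patchE; case: ifPn => wE.
    rewrite [LHS]integral_mkcond.
    apply: eq_integral => y _.
    rewrite /g !patchE; congr (if _ then _ else _).
    by rewrite in_setX/= wE.
  rewrite integral0_eq// => y _.
  by rewrite /g patchE in_setX/= (negbTE wE).
have m12 A : measurable A -> m1 A = m2 A.
  apply: (measure_unique
    [set C | exists E, measurable E /\ exists B, measurable B /\ C = E `*` B]
    (fun=> setT)).
  - rewrite measurable_prod_measurableType//; congr (<<s _ >>).
    rewrite predeqE; split => [[E mE [B mB <-]]|[E [mE [B [mB ->]]]]].
      by exists E; split => //; exists B.
    by exists E => //; exists B.
  - move=> _ _ [E1 [mE1 [B1 [mB1 ->]]]] [E2 [mE2 [B2 [mB2 ->]]]].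
    rewrite -setXI; exists (E1 `&` E2); split; first exact: measurableI.
    by exists (B1 `&` B2); split => //; exact: measurableI.
  - by move=> _; exists setT; split => //; exists setT; split => //; rewrite setXTT.
  - by apply/seteqP; split => // x _; exists 0%N.
  - by move=> _ [E [mE [B [mB ->]]]]; exact: rect.
  - move=> _; have -> : m1 setT = P setT by [].
    by rewrite probability_setT ltry.
have -> : \int[P]_w phi (w : GT, Y w) = \int[m1]_p phi p.
  by have := @ge0_integral_pushforward _ _ _ _ R _ mpair P setT phi
    measurableT mphi (fun y _ => phi0 y); rewrite preimage_setT => ->.
rewrite (eq_measure_integral m2) => [|A mA _]; last exact: m12.
rewrite (ge0_integral_density mf (fun p => f0 p.1 p.2) (fun A _ => m2E A))//.
have mpf : measurable_fun [set: GT * R] (fun p => phi p * (f p.1 p.2)%:E).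
  by apply: emeasurable_funM => //; exact/measurable_EFinP.
have pf0 p : 0 <= phi p * (f p.1 p.2)%:E by rewrite mule_ge0 ?lee_fin.
rewrite (@fubini_tonelli1 _ _ _ _ _ PG nu (fun p => phi p * (f p.1 p.2)%:E))//.
rewrite PGE//.
- exact: (measurable_fun_fubini_tonelli_F (fun p => phi p * (f p.1 p.2)%:E)).
- by move=> w; apply: integral_ge0.
Qed.

End conditional_density.

(** * Lebesgue measure on column vectors and Gaussian integrals *)

Section measurable_mx.
Context {disp : measure_display} {T : measurableType disp} {p q : nat}.

Lemma measurable_coord (i : 'I_p) (j : 'I_q) :
  measurable_fun [set: 'M[T]_(p, q)] (fun M : 'M[T]_(p, q) => M i j).
Proof.
move=> _ B mB; apply: sub_sigma_algebra; exists (i, j) => //.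
by exists B.
Qed.

Lemma measurable_fun_mxP {d'} {U : measurableType d'} (f : U -> 'M[T]_(p, q)) :
  measurable_fun [set: U] f <->
  forall i j, measurable_fun [set: U] (fun u => f u i j).
Proof.
split=> [mf i j|mf]; first exact: measurableT_comp (measurable_coord i j) mf.
apply: measurability; first by reflexivity.
move=> _ [_ [[i j] _ [B mB <-]] <-]; rewrite !setTI.
by have := mf i j measurableT B mB; rewrite setTI.
Qed.

End measurable_mx.

Section lebesgue_cV_theory.
Context {R : realType}.

(** Names the map inside the recursive clause of [lebesgue_cV]. *)
Definition consv {n} (p : R * 'cV[R]_n) : 'cV[R]_n.+1 := col_mx p.1%:M p.2.

Definition unconsv {n} (v : 'cV[R]_n.+1) : R * 'cV[R]_n :=
  (v 0 0, dsubmx (v : 'cV[R]_(1 + n))).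

Lemma consvK n : cancel (@consv n) unconsv.
Proof.
move=> [y u]; rewrite /unconsv /consv /= col_mxKd; congr pair.
rewrite (_ : 0 = lshift n (0 : 'I_1)); last exact/val_inj.
by rewrite (@col_mxEu R 1 n 1) mxE eqxx mulr1n.
Qed.

Lemma measurable_consv n : measurable_fun [set: R * 'cV[R]_n] consv.
Proof.
apply/measurable_fun_mxP => i j.
rewrite /consv; case: (@split_ordP 1 n i) => k ->.
  under eq_fun do rewrite (@col_mxEu R 1 n 1) mxE [j]ord1 [k]ord1 mulr1n.
  exact: measurable_fst.
under eq_fun do rewrite (@col_mxEd R 1 n 1).
exact: (measurableT_comp (measurable_coord k j) measurable_snd).
Qed.

Lemma measurable_unconsv n : measurable_fun [set: 'cV[R]_n.+1] unconsv.
Proof.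
apply: measurable_fun_pair; first exact: measurable_coord.
apply/measurable_fun_mxP => i j; rewrite /dsubmx.
under eq_fun do rewrite mxE.
exact: measurable_coord.
Qed.

(** [lebesgue_cV] is a bare set function, while integration theory wants a bundled measure.
    Sigma-finiteness comes along because the next dimension needs it to form the product. *)
Lemma lebesgue_cV_sigma_finite n :
  exists mu : {sigma_finite_measure set 'cV[R]_n -> \bar R},
    lebesgue_cV (n := n) = mu.
Proof.
elim: n => [|n [mu muE]]; first by exists (dirac (0 : 'cV[R]_0)).
pose leb : {sigma_finite_measure set (measurableTypeR R) -> \bar R} := lebesgue_measure.
pose m : {measure set 'cV[R]_n.+1 -> \bar R} :=
  measure_function_pushforward__canonical__measure_function_Measure (leb \x mu)%E
    (@measurable_consv n).
have /sigma_finiteP[F [TF ndF Foo]] := sigma_finiteT leb.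
have /sigma_finiteP[G [TG ndG Goo]] := sigma_finiteT mu.
have sm : sigma_finite setT m.
  exists (fun k => unconsv @^-1` (F k `*` G k)).
    apply/seteqP; split => // v _.
    have [i _ Fi] : (\bigcup_k F k) (unconsv v).1 by rewrite -TF.
    have [j _ Gj] : (\bigcup_k G k) (unconsv v).2 by rewrite -TG.
    (* Both exhaustions are nondecreasing, so the larger index serves the two coordinates at
       once. *)
    exists (maxn i j) => //; split.
      by move: Fi; exact/subsetPset/ndF/leq_maxl.
    by move: Gj; exact/subsetPset/ndG/leq_maxr.
  move=> k; have [mF Fk] := Foo k; have [mG Gk] := Goo k; split.
    rewrite -[X in measurable X]setTI; apply: measurable_unconsv => //.
    exact: measurableX.
  rewrite /m /= /pushforward -comp_preimage (_ : unconsv \o consv = id); last first.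
    by apply/funext => x; exact: consvK.
  rewrite preimage_id.
  rewrite (@product_measure1E _ _ _ _ R leb mu)// lte_mul_pinfty//.
  by rewrite ge0_fin_numE.
pose mM := Measure_isSigmaFinite.Build _ _ _ m sm.
exists (HB.pack_for {sigma_finite_measure set 'cV[R]_n.+1 -> \bar R}
  (m : set _ -> \bar R) (Measure.class m) mM).
by rewrite /= muE.
Qed.

Lemma ge0_integral_lebesgue_cVS n (f : 'cV[R]_n.+1 -> \bar R) :
  measurable_fun [set: 'cV[R]_n.+1] f -> (forall v, 0 <= f v)%E ->
  (\int[lebesgue_cV (n := n.+1)]_v f v =
   \int[lebesgue_measure]_y \int[lebesgue_cV (n := n)]_u f (consv (y, u)))%E.
Proof.
move=> mf f0; have [mu muE] := lebesgue_cV_sigma_finite n.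
rewrite /= muE.
pose leb : {sigma_finite_measure set (measurableTypeR R) -> \bar R} := lebesgue_measure.
have mc : measurable_fun [set: (measurableTypeR R * 'cV[R]_n)%type] consv.
  exact: measurable_consv.
have := @ge0_integral_pushforward _ _ _ _ R _ mc (leb \x mu)%E setT f measurableT mf
  (fun y _ => f0 y).
rewrite preimage_setT => H; apply: etrans; first exact: H.
apply: (@fubini_tonelli1 _ _ _ _ _ leb mu (f \o consv)).
  exact: measurableT_comp mf mc.
by move=> p; exact: f0.
Qed.

End lebesgue_cV_theory.

Section dotv_theory.
Context {R : realType} {n : nat}.
Implicit Types u v w : 'cV[R]_n.

Lemma dotvE u v : dotv u v = \sum_i u i 0 * v i 0.
Proof. by rewrite /dotv mxE; apply: eq_bigr => i _; rewrite mxE. Qed.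

Lemma dotvC u v : dotv u v = dotv v u.
Proof. by rewrite !dotvE; apply: eq_bigr => i _; rewrite mulrC. Qed.

Lemma dotvDr u v w : dotv u (v + w) = dotv u v + dotv u w.
Proof. by rewrite /dotv mulmxDr mxE. Qed.

Lemma dotvDl u v w : dotv (u + v) w = dotv u w + dotv v w.
Proof. by rewrite !(dotvC _ w) dotvDr. Qed.

Lemma dotvZr u a v : dotv u (a *: v) = a * dotv u v.
Proof. by rewrite /dotv -scalemxAr mxE. Qed.

Lemma dotvZl u a v : dotv (a *: u) v = a * dotv u v.
Proof. by rewrite dotvC dotvZr dotvC. Qed.

Lemma dotvNr u v : dotv u (- v) = - dotv u v.
Proof. by rewrite -scaleN1r dotvZr mulN1r. Qed.

Lemma dotvNl u v : dotv (- u) v = - dotv u v.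
Proof. by rewrite dotvC dotvNr dotvC. Qed.

Lemma dotv_mulmx (A : 'M[R]_n) u v : dotv u (A *m v) = dotv (A^T *m u) v.
Proof. by rewrite /dotv trmx_mul trmxK mulmxA. Qed.

Lemma dotv_ge0 v : 0 <= dotv v v.
Proof. by rewrite dotvE; apply: sumr_ge0 => i _; rewrite -expr2 sqr_ge0. Qed.

Lemma dotv_eq0 v : (dotv v v == 0) = (v == 0).
Proof.
apply/idP/eqP => [|->]; last by rewrite -(scale0r (0 : 'cV_n)) dotvZl mul0r.
rewrite dotvE psumr_eq0 => [/allP h|i _]; last by rewrite -expr2 sqr_ge0.
apply/colP => i; rewrite mxE; apply/eqP; rewrite -sqrf_eq0 expr2.
by apply: (h i); rewrite mem_index_enum.
Qed.

Lemma dotv_gt0 v : v != 0 -> 0 < dotv v v.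
Proof. by move=> v0; rewrite lt_neqAle dotv_ge0 andbT eq_sym dotv_eq0. Qed.

End dotv_theory.

Section measurable_mulmx.
Context {R : realType} {d} {T : measurableType d}.

Lemma measurable_mulmx p q r (f : T -> 'M[R]_(p, q)) (g : T -> 'M[R]_(q, r)) :
  measurable_fun [set: T] f -> measurable_fun [set: T] g ->
  measurable_fun [set: T] (fun w => f w *m g w).
Proof.
move=> /measurable_fun_mxP mf /measurable_fun_mxP mg; apply/measurable_fun_mxP => i j.
under eq_fun do rewrite mxE.
by apply: measurable_sum => k; exact: measurable_funM.
Qed.

Lemma measurable_addmx p q (f g : T -> 'M[R]_(p, q)) :
  measurable_fun [set: T] f -> measurable_fun [set: T] g ->
  measurable_fun [set: T] (fun w => f w + g w).
Proof.
move=> /measurable_fun_mxP mf /measurable_fun_mxP mg; apply/measurable_fun_mxP => i j.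
by under eq_fun do rewrite mxE; exact: measurable_funD.
Qed.

Lemma measurable_scalemx p q (a : T -> R) (f : T -> 'M[R]_(p, q)) :
  measurable_fun [set: T] a -> measurable_fun [set: T] f ->
  measurable_fun [set: T] (fun w => a w *: f w).
Proof.
move=> ma /measurable_fun_mxP mf; apply/measurable_fun_mxP => i j.
by under eq_fun do rewrite mxE; exact: measurable_funM.
Qed.

Lemma measurable_submx p q (f g : T -> 'M[R]_(p, q)) :
  measurable_fun [set: T] f -> measurable_fun [set: T] g ->
  measurable_fun [set: T] (fun w => f w - g w).
Proof.
move=> mf mg; under eq_fun do rewrite -scaleN1r.
by apply: measurable_addmx => //; exact: measurable_scalemx.
Qed.

Lemma measurable_trmx p q (f : T -> 'M[R]_(p, q)) :
  measurable_fun [set: T] f -> measurable_fun [set: T] (fun w => (f w)^T).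
Proof.
move=> /measurable_fun_mxP mf; apply/measurable_fun_mxP => i j.
by under eq_fun do rewrite mxE; exact: mf.
Qed.

Lemma measurable_dotv n (f g : T -> 'cV[R]_n) :
  measurable_fun [set: T] f -> measurable_fun [set: T] g ->
  measurable_fun [set: T] (fun w => dotv (f w) (g w)).
Proof.
move=> /measurable_fun_mxP mf /measurable_fun_mxP mg.
under eq_fun do rewrite dotvE.
by apply: measurable_sum => k; exact: measurable_funM.
Qed.

Lemma measurable_det n (f : T -> 'M[R]_n) :
  measurable_fun [set: T] f -> measurable_fun [set: T] (fun w => \det (f w)).
Proof.
move=> /measurable_fun_mxP mf; apply: measurable_sum => s.
by apply: measurable_funM => //; apply: measurable_prod => i _.
Qed.

End measurable_mulmx.

(** * Positive definite matrices and Schur complements *)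

Section posdef.
Context {R : realType}.

Definition posdef n (M : 'M[R]_n) : Prop :=
  M^T = M /\ forall v : 'cV[R]_n, v != 0 -> 0 < dotv v (M *m v).

(** By symmetry a left null vector is also a right null vector, and the quadratic form would vanish
    on it. *)
Lemma posdef_unitmx n (M : 'M[R]_n) : posdef M -> M \in unitmx.
Proof.
move=> [Ms Mp]; rewrite unitmxE unitfE; apply/det0P => -[v v0 vM].
have := Mp v^T; rewrite trmx_eq0 => /(_ v0).
by rewrite -[M]Ms -trmx_mul vM trmx0 /dotv mulmx0 mxE ltxx.
Qed.

Lemma posdefZ n (M : 'M[R]_n) a : 0 < a -> posdef M -> posdef (a *: M).
Proof.
move=> a0 [Ms Mp]; split=> [|v v0]; first by rewrite linearZ/= Ms.
by rewrite -scalemxAl dotvZr mulr_gt0// Mp.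
Qed.

(** Completing the square in [u]: the shift by [y D^-1 w] absorbs the cross terms and leaves the
    Schur complement of [D] as the coefficient of [y^2]. *)
Lemma schur_quad n (a y : R) (w u : 'cV[R]_n) (D : 'M[R]_n) :
  D^T = D -> D \in unitmx ->
  let z := u + y *: (invmx D *m w) in
  let M : 'M[R]_(1 + n) := block_mx a%:M w^T w D in
  let v : 'cV[R]_(1 + n) := col_mx y%:M u in
  dotv v (M *m v) =
  dotv z (D *m z) + (a - dotv w (invmx D *m w)) * y ^+ 2.
Proof.
move=> Ds Du z M v; rewrite /M /v /z mul_block_col {1}/dotv tr_col_mx mul_row_col mxE.
set q := invmx D *m w.
have Dq : D *m q = w by rewrite /q mulmxA mulmxV// mul1mx.
have -> : (y%:M^T *m (a%:M *m y%:M + w^T *m u)) 0 0 = y * (a * y + dotv w u).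
  by rewrite tr_scalar_mx mul_scalar_mx -scalar_mxM /dotv !mxE eqxx mulr1n.
rewrite -/(dotv u _) mul_mx_scalar mulmxDr -scalemxAr Dq.
rewrite !(dotvDr, dotvDl, dotvZr, dotvZl) dotv_mulmx Ds.
rewrite [dotv q (D *m u)]dotv_mulmx Ds Dq (dotvC q w) (dotvC u w).
by rewrite [dotv (D *m u) u]dotvC; ring.
Qed.

(** Block elimination: a unit upper triangular factor clears the upper right block and puts the
    Schur complement in the corner. *)
Lemma schur_det n (a : R) (w : 'cV[R]_n) (D : 'M[R]_n) :
  D^T = D -> D \in unitmx ->
  \det (block_mx a%:M w^T w D : 'M[R]_(1 + n)) =
  (a - dotv w (invmx D *m w)) * \det D.
Proof.
move=> Ds Du.
have -> : (block_mx a%:M w^T w D : 'M[R]_(1 + n)) =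
    block_mx 1%:M (w^T *m invmx D) 0 1%:M *m
    block_mx (a - dotv w (invmx D *m w))%:M 0 w D.
  rewrite mulmx_block !mul1mx !mul0mx !add0r -!mulmxA mulVmx// mulmx1.
  congr block_mx; rewrite [X in _ + X]mx11_scalar -raddfD/=.
  by rewrite -/(dotv _ _) subrK.
by rewrite det_mulmx det_ublock det_lblock !det1 det_scalar1 !mul1r.
Qed.

(** Two families of test vectors suffice: [(0, u)] shows that [D] is positive definite, and
    [(1, - D^-1 w)] annihilates the square in [schur_quad], so that the quadratic form there is the
    Schur complement itself. *)
Lemma posdef_block n (M : 'M[R]_(1 + n)) : posdef M ->
  exists (a : R) (w : 'cV[R]_n) (D : 'M[R]_n),
    [/\ M = block_mx a%:M w^T w D, posdef D & 0 < a - dotv w (invmx D *m w)].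
Proof.
move=> [Ms Mp].
exists (ulsubmx M 0 0), (dlsubmx M), (drsubmx M).
set w := dlsubmx M; set D := drsubmx M.
have ME : M = block_mx (ulsubmx M 0 0)%:M w^T w D.
  by rewrite -mx11_scalar trmx_dlsub Ms submxK.
have Ds : D^T = D by rewrite trmx_drsub Ms.
have Dp : posdef D.
  split=> // u u0; have := Mp (col_mx 0 u); rewrite col_mx_eq0 negb_and u0 orbT.
  move=> /(_ isT); rewrite ME mul_block_col !mulmx0 !add0r.
  by rewrite {1}/dotv tr_col_mx mul_row_col trmx0 mul0mx add0r.
split=> //; have := Mp (col_mx 1%:M (- (invmx D *m w))).
rewrite col_mx_eq0 negb_and -[1%:M]/1 oner_neq0 => /(_ isT).
rewrite ME schur_quad ?posdef_unitmx// scale1r addNr mulmx0 expr1n mulr1.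
have -> : dotv (0 : 'cV[R]_n) 0 = 0 by rewrite /dotv mulmx0 mxE.
by rewrite add0r -ME.
Qed.

Lemma posdef_det_gt0 n (M : 'M[R]_n) : posdef M -> 0 < \det M.
Proof.
elim: n M => [|n IH] M Mp; first by rewrite det_mx00.
have [a [w [D [-> Dp s0]]]] := posdef_block Mp.
by rewrite schur_det ?posdef_unitmx ?(proj1 Dp)// mulr_gt0// IH.
Qed.

End posdef.

Section gaussian_integral.
Context {R : realType}.

(** The normal density with standard deviation [s^(-1/2)] has mass 1; dividing by its peak value
    gives the unnormalised integral. *)
Lemma integral_gauss1 (s b : R) : 0 < s ->
  (\int[lebesgue_measure]_y (expR (- (s * (y - b) ^+ 2 / 2)))%:E =
   (Num.sqrt (2 * pi / s))%:E)%E.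
Proof.
move=> s0; pose sg := (Num.sqrt s)^-1.
have sg0 : sg != 0 by rewrite invr_neq0// gt_eqF// sqrtr_gt0.
have sg2 : sg ^+ 2 = s^-1 by rewrite exprVn sqr_sqrtr// ltW.
have pk : 0 < normal_peak sg by exact: normal_peak_gt0.
have := integral_normal_pdf b sg; rewrite normal_pdfE//.
under eq_integral do rewrite EFinM.
rewrite ge0_integralZl//; last 3 first.
- by apply/measurable_EFinP; exact: measurable_normal_fun.
- by move=> y _; rewrite lee_fin expR_ge0.
- by rewrite lee_fin ltW.
under eq_integral => y _.
  rewrite /normal_fun sg2 (_ : _ / _ = - (s * (y - b) ^+ 2 / 2)); last first.
    by field; rewrite gt_eqF.
  over.
move=> /(congr1 (fun z => ((normal_peak sg)^-1)%:E * z)%E).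
rewrite muleA -EFinM mulVf ?gt_eqF// mul1e mule1 => ->.
by rewrite /normal_peak invrK sg2 -mulr_natl; congr (Num.sqrt _)%:E; ring.
Qed.

Lemma measurable_gauss n (K : 'M[R]_n) (c : 'cV[R]_n) :
  measurable_fun [set: 'cV[R]_n]
    (fun v => expR (- (dotv (v - c) (K *m (v - c)) / 2))).
Proof.
apply: measurableT_comp => //.
apply: measurable_funN; apply: measurable_funM => //.
by apply: measurable_dotv; [|apply: measurable_mulmx => //]; exact: measurable_submx.
Qed.

(* Completing the square in the last n coordinates only moves the center, so the
   induction hypothesis for every center replaces translation invariance. *)
Lemma integral_gauss n (K : 'M[R]_n) (c : 'cV[R]_n) : posdef K ->
  (\int[lebesgue_cV (n := n)]_v
     (expR (- (dotv (v - c) (K *m (v - c)) / 2)))%:E =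
   (Num.sqrt ((2 * pi) ^+ n / \det K))%:E)%E.
Proof.
elim: n K c => [|n IH] K c Kp.
  rewrite /= integral_dirac//; last by apply/measurable_EFinP; exact: measurable_gauss.
  rewrite diracT mul1e det_mx00 expr0 divr1 sqrtr1.
  by rewrite dotvE big_ord0 mul0r oppr0 expR0.
rewrite ge0_integral_lebesgue_cVS; last 2 first.
- by apply/measurable_EFinP; exact: measurable_gauss.
- by move=> v; rewrite lee_fin expR_ge0.
have [a [w [D [KE Dp s0]]]] := posdef_block Kp.
have Du := posdef_unitmx Dp.
set s := a - _ in s0.
pose c0 := c 0 0; pose c' := dsubmx (c : 'cV[R]_(1 + n)).
have cu : usubmx (c : 'cV[R]_(1 + n)) = c0%:M.
  apply/matrixP => i j; rewrite !mxE !ord1 eqxx mulr1n.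
  by rewrite (_ : lshift n 0 = 0)//; exact/val_inj.
have cE : c = col_mx c0%:M c' by rewrite -cu; symmetry; exact: (@vsubmxK R 1 n 1 c).
have [mu muE] := @lebesgue_cV_sigma_finite R n; rewrite muE in IH *.
transitivity (\int[lebesgue_measure]_y
   ((Num.sqrt ((2 * pi) ^+ n / \det D))%:E * (expR (- (s * (y - c0) ^+ 2 / 2)))%:E)%E)%E.
  apply: eq_integral => y _.
  rewrite -(IH D (c' - (y - c0) *: (invmx D *m w)) Dp) -ge0_integralZr;
    [|exact: measurableT|by apply/measurable_EFinP; exact: measurable_gauss
     |by move=> u _; rewrite lee_fin expR_ge0|by rewrite lee_fin expR_ge0].
  apply: eq_integral => u _; rewrite -EFinM -expRD; congr (expR _)%:E.
  have -> : consv (y, u) - c = (col_mx (y - c0)%:M (u - c') : 'cV[R]_(1 + n)).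
    by rewrite raddfB/= -add_col_mx -opp_col_mx {1}cE.
  rewrite KE.
  rewrite schur_quad ?(proj1 Dp)// -/s.
  rewrite opprB addrA addrAC; lra.
rewrite ge0_integralZl; [|exact: measurableT| |
  by move=> y _; rewrite lee_fin expR_ge0|by rewrite lee_fin sqrtr_ge0]; last first.
  apply/measurable_EFinP; apply: measurableT_comp => //.
  apply: measurable_funN; apply: measurable_funM => //.
  apply: measurable_funM => //; apply: measurable_funX.
  exact: measurable_funB.
rewrite integral_gauss1// -EFinM KE schur_det ?(proj1 Dp)// -/s.
have dD := posdef_det_gt0 Dp.
rewrite -sqrtrM; last by rewrite divr_ge0// ?exprn_ge0 ?mulr_ge0 ?pi_ge0// ltW.
congr (Num.sqrt _)%:E; rewrite exprS; field.
by rewrite !gt_eqF.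
Qed.

End gaussian_integral.

(** * Gaussian laws parametrised by their precision matrix *)

Section gaussian_law.
Context {R : realType} {n : nat}.
Variables (K : 'M[R]_n) (c : 'cV[R]_n).
Hypothesis Kp : posdef K.

(** With the precision [K] in place of the covariance no matrix inverse remains, so joint
    measurability in [K], [c] and [v] reduces to that of determinants and matrix products. *)
Lemma gaussian_pdfE v : gaussian_pdf c (invmx K) v =
  Num.sqrt (\det K / (2 * pi) ^+ n) * expR (- (dotv (v - c) (K *m (v - c)) / 2)).
Proof.
rewrite /gaussian_pdf invmxK det_inv; congr (_ * _).
rewrite -sqrtrV ?invfM ?invrK ?[_^-1 * _]mulrC//.
by rewrite mulr_ge0 ?exprn_ge0 ?mulr_ge0 ?pi_ge0// invr_ge0 ltW// posdef_det_gt0.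
Qed.

Lemma gaussian_pdf_gt0 v : 0 < gaussian_pdf c (invmx K) v.
Proof.
rewrite gaussian_pdfE mulr_gt0 ?expR_gt0// sqrtr_gt0 divr_gt0 ?posdef_det_gt0//.
by rewrite exprn_gt0// mulr_gt0// pi_gt0.
Qed.

Lemma measurable_gaussian_pdf :
  measurable_fun [set: 'cV[R]_n] (gaussian_pdf c (invmx K)).
Proof.
rewrite (_ : gaussian_pdf _ _ = fun v => Num.sqrt (\det K / (2 * pi) ^+ n) *
  expR (- (dotv (v - c) (K *m (v - c)) / 2))); last first.
  by apply/funext => v; rewrite gaussian_pdfE.
by apply: measurable_funM => //; exact: measurable_gauss.
Qed.

Lemma integral_gaussian_pdf :
  (\int[lebesgue_cV (n := n)]_v (gaussian_pdf c (invmx K) v)%:E = 1)%E.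
Proof.
have [mu muE] := @lebesgue_cV_sigma_finite R n.
rewrite muE; under eq_integral do rewrite gaussian_pdfE EFinM.
rewrite ge0_integralZl; [|exact: measurableT|by apply/measurable_EFinP; exact: measurable_gauss
  |by move=> y _; rewrite lee_fin expR_ge0|by rewrite lee_fin sqrtr_ge0].
have := integral_gauss c Kp; rewrite muE => ->.
rewrite -EFinM -sqrtrM; last first.
  by rewrite divr_ge0 ?exprn_ge0 ?mulr_ge0 ?pi_ge0// ltW// posdef_det_gt0.
have dK := posdef_det_gt0 Kp.
have pi0 : 0 < (2 * pi : R) ^+ n by rewrite exprn_gt0// mulr_gt0// pi_gt0.
rewrite (_ : _ * _ = 1) ?sqrtr1//; field.
by rewrite !gt_eqF.
Qed.

Lemma integral_gaussian_prob (phi : 'cV[R]_n -> \bar R) :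
  measurable_fun [set: 'cV[R]_n] phi -> (forall v, 0 <= phi v)%E ->
  (\int[gaussian_prob c (invmx K)]_v phi v =
   \int[lebesgue_cV (n := n)]_v (phi v * (gaussian_pdf c (invmx K) v)%:E))%E.
Proof.
move=> mphi phi0; have [mu muE] := @lebesgue_cV_sigma_finite R n.
have pdf0 v : 0 <= gaussian_pdf c (invmx K) v by rewrite ltW// gaussian_pdf_gt0.
have [mP mPE] := exists_density_measure mu measurable_gaussian_pdf pdf0.
rewrite (_ : gaussian_prob _ _ = mP); last first.
  by apply/funext => B; rewrite mPE /gaussian_prob muE.
by rewrite muE; apply: ge0_integral_density => //; exact: measurable_gaussian_pdf.
Qed.

(** Needed so that [ln] in the mix loss is applied to a positive number. A zero integral would make
    a strictly positive integrand vanish almost everywhere. *)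
Lemma integral_gaussian_prob_gt0 (phi : 'cV[R]_n -> R) :
  measurable_fun [set: 'cV[R]_n] phi -> (forall v, 0 < phi v) ->
  (0 < \int[gaussian_prob c (invmx K)]_v (phi v)%:E)%E.
Proof.
move=> mphi phi0; have [mu muE] := @lebesgue_cV_sigma_finite R n.
have mEphi : measurable_fun [set: 'cV[R]_n] (fun v => (phi v)%:E).
  exact/measurable_EFinP.
rewrite integral_gaussian_prob// => [|v]; last by rewrite lee_fin ltW.
pose f v := phi v * gaussian_pdf c (invmx K) v.
have mf : measurable_fun [set: 'cV[R]_n] (EFin \o f).
  by apply/measurable_EFinP/measurable_funM => //; exact: measurable_gaussian_pdf.
have f0 v : 0 < f v by rewrite mulr_gt0// gaussian_pdf_gt0.
rewrite muE; under eq_integral do rewrite -EFinM -/(f _).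
rewrite lt0e integral_ge0 ?andbT; last by move=> v _; rewrite lee_fin ltW.
apply/eqP => I0.
have f_ae0 : ae_eq mu setT (EFin \o f) (cst 0%E).
  apply/(ae_eq_integral_abs _ measurableT mf); rewrite -[RHS]I0.
  by apply: eq_integral => v _; rewrite gee0_abs// lee_fin ltW.
(* The almost-everywhere equation is false at every point, so any other may be drawn from it;
   vanishing of the density contradicts its total mass 1. *)
have pdf_ae0 : ae_eq mu setT (EFin \o gaussian_pdf c (invmx K)) (cst 0%E).
  apply: filterS f_ae0 => v /(_ I) /= [fv0] _.
  by have := f0 v; rewrite fv0 ltxx.
have := integral_gaussian_pdf; rewrite muE.
have mpdf : measurable_fun [set: 'cV[R]_n] (EFin \o gaussian_pdf c (invmx K)).
  by apply/measurable_EFinP; exact: measurable_gaussian_pdf.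
have -> : (\int[mu]_v (gaussian_pdf c (invmx K) v)%:E = \int[mu]_v cst 0 v)%E.
  by apply: ae_eq_integral.
rewrite integral0 => -[] /esym/eqP.
by rewrite oner_eq0.
Qed.

End gaussian_law.

(** * Derivatives of the loss *)

Section glm_calculus.
Context {R : realType}.
Implicit Types (m F : R -> R).

Lemma C3_derivable m z : C3 m ->
  [/\ derivable m z 1, derivable (derive1 m) z 1 & derivable (derive1 (derive1 m)) z 1].
Proof. by move=> [dm _]; split; [exact: (dm 0%N)|exact: (dm 1%N)|exact: (dm 2%N)]. Qed.

Lemma derivable_continuous F : (forall z, derivable F z 1) -> continuous F.
Proof. by move=> dF z; apply: differentiable_continuous; exact/derivable1_diffP. Qed.

Lemma MVT_derive1 F (a b : R) : (forall z, derivable F z 1) -> a < b ->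
  exists2 c, a < c < b & F b - F a = (derive1 F) c * (b - a).
Proof.
move=> dF ab; have [||c] := @MVT R F (derive1 F) a b ab.
- by move=> x _; rewrite derive1E; exact: derivableP.
- by apply: continuous_subspaceT; exact: derivable_continuous.
by rewrite in_itv => cab ->; exists c.
Qed.

(* If m'' were negative near z, the mean value theorem would make m' strictly
   decreasing there and m strictly midpoint-concave. *)
Lemma convex_derive2_ge0 m z : convex_function [set: convex_lmodType R^o] m ->
  C3 m -> 0 <= (derive1 (derive1 m)) z.
Proof.
move=> cm hm; rewrite leNgt; apply/negP => mz.
have d0 x := let: And3 h _ _ := C3_derivable x hm in h.
have d1 x := let: And3 _ h _ := C3_derivable x hm in h.
have d2 x := let: And3 _ _ h := C3_derivable x hm in h.
have : \forall x \near z, (derive1 (derive1 m)) x < 0.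
  by have := derivable_continuous d2 (x := z) => /cvgr_lt; apply.
move=> /nbhs_ballP[e /= e0 he].
have e2 : 0 < e / 2 by rewrite divr_gt0.
set a := z - e / 2; set b := z + e / 2.
have az : a < z by rewrite ltrBlDr ltrDl.
have zb : z < b by rewrite ltrDl.
have neg x : a < x -> x < b -> (derive1 (derive1 m)) x < 0.
  move=> ax xb; apply: he; rewrite /ball/= ltr_distlC.
  have ee : e / 2 <= e by rewrite ler_pdivrMr// ler_peMr ?ler1n// ltW.
  by rewrite (lt_le_trans xb) ?lerD2l// (le_lt_trans _ ax)// lerD2l lerN2.
have [c1 /andP[ac1 c1z] E1] := MVT_derive1 d0 az.
have [c2 /andP[zc2 c2b] E2] := MVT_derive1 d0 zb.
have [c3 /andP[c13 c32] E3] := MVT_derive1 d1 (lt_trans c1z zc2).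
have n3 : (derive1 (derive1 m)) c3 < 0.
  by apply: neg; [exact: lt_trans ac1 c13|exact: lt_trans c32 c2b].
have lt12 : (derive1 m) c2 < (derive1 m) c1.
  by rewrite -subr_lt0 E3 nmulr_rlt0// subr_gt0 (lt_trans c13).
have h01 : (0 <= (2^-1 : R) <= 1) by rewrite invr_ge0 ler0n invf_le1// ler1n.
pose t : {i01 R} := Itv01 (proj1 (andP h01)) (proj2 (andP h01)).
have : m (2^-1 * a + (1 - 2^-1) * b) <= 2^-1 * m a + (1 - 2^-1) * m b.
  exact: cm t a b (in_setT _) (in_setT _).
have -> : 2^-1 * a + (1 - 2^-1) * b = z by rewrite /a /b; field.
have bz : b - z = e / 2 by rewrite /b addrC addKr.
have za : z - a = e / 2 by rewrite /a opprB addrC subrK.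
have : m b - m z < m z - m a by rewrite E1 E2 bz za ltr_pM2r.
have absurd (p q s : R) : q - s < s - p -> s <= 2^-1 * p + (1 - 2^-1) * q -> False.
  by clear; lra.
exact: absurd.
Qed.

(** Along [delta_mx i 0] the argument [dotv x u] moves with slope [x i 0], so the difference
    quotients are literally those of [F] in the direction [x i 0]; the differential is then linear
    in the direction. *)
Lemma derive_dotv n F (x v : 'cV[R]_n) i : derivable F (dotv x v) 1 ->
  'D_(delta_mx i 0) (fun u => F (dotv x u)) v = (derive1 F) (dotv x v) * x i 0.
Proof.
move=> dF.
have -> : 'D_(delta_mx i 0) (fun u => F (dotv x u)) v = 'D_(x i 0) F (dotv x v).
  rewrite /derive /shift /=.
  suff xe : dotv x (delta_mx i 0) = x i 0.
    by under eq_fun do rewrite dotvDr dotvZr xe.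
  rewrite dotvE (bigD1 i)//= big1 => [|j ji].
    by rewrite mxE !eqxx mulr1 addr0.
  by rewrite mxE (negbTE ji) mulr0.
have /derivable1_diffP dF' := dF.
by rewrite deriveE// diff1E//= mulrC.
Qed.

Lemma derive1_glm (m g : R -> R) (tau r z : R) : derivable m z 1 ->
  is_derive z 1 (fun z => (m z - r * z) / g tau) (((derive1 m) z - r) / g tau).
Proof.
move=> dm; have im : is_derive z 1 m ((derive1 m) z) by rewrite derive1E; exact: derivableP.
rewrite (_ : (fun z => _) = (m - r \*: id) * cst (g tau)^-1)//.
apply: is_derive_eq; rewrite scaler0 add0r /GRing.scale/= mulr1; exact: mulrC.
Qed.

Lemma grad_glm_loss n (m g : R -> R) tau (x : 'cV[R]_n) r v : C3 m ->
  grad (glm_loss m g tau x r) v = (((derive1 m) (dotv x v) - r) / g tau) *: x.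
Proof.
move=> hm; apply/colP => i; rewrite !mxE /glm_loss.
have [d0 _ _] := C3_derivable (dotv x v) hm.
have id0 := derive1_glm g tau r d0.
rewrite (derive_dotv (F := fun z => (m z - r * z) / g tau))//.
by rewrite derive1E derive_val.
Qed.

(** The first partial derivatives are again functions of [dotv x u], so [derive_dotv] applies a
    second time. *)
Lemma hess_glm_loss n (m g : R -> R) tau (x : 'cV[R]_n) r v : C3 m ->
  hess (glm_loss m g tau x r) v = ((derive1 (derive1 m)) (dotv x v) / g tau) *: (x *m x^T).
Proof.
move=> hm; apply/matrixP => i j; rewrite !mxE big_ord1 !mxE.
have [_ d1 _] := C3_derivable (dotv x v) hm.
have -> : (fun u => 'D_(delta_mx j 0) (glm_loss m g tau x r) u) =
    (fun u => (fun z => ((derive1 m) z - r) / g tau * x j 0) (dotv x u)).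
  apply/funext => u; have := grad_glm_loss g tau x r u hm => /colP/(_ j).
  by rewrite !mxE.
have im : is_derive (dotv x v) 1 (derive1 m) ((derive1 (derive1 m)) (dotv x v)).
  by rewrite [X in is_derive _ _ _ X]derive1E; exact: derivableP.
have H' : is_derive (dotv x v) 1 (fun z => ((derive1 m) z - r) / g tau * x j 0)
    ((derive1 (derive1 m)) (dotv x v) / g tau * x j 0).
  rewrite (_ : (fun z => _) = ((derive1 m) - cst r) * cst ((g tau)^-1 * x j 0)); last first.
    by apply/funext => z; rewrite !fctE mulrA.
  apply: is_derive_eq.
  by rewrite scaler0 add0r subr0 /GRing.scale/=; ring.
rewrite (derive_dotv (F := fun z => ((derive1 m) z - r) / g tau * x j 0))//.
by rewrite derive1E derive_val; ring.
Qed.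

End glm_calculus.

(** * Measurability of the mirror-descent iterates *)

Section continuous_mx.
Context {R : realType} {U : topologicalType}.

Lemma continuous_rsum (I : Type) (s : seq I) (F : I -> U -> R) :
  (forall i, continuous (F i)) -> continuous (fun u => \sum_(i <- s) F i u).
Proof.
move=> cF u; elim: s => [|i s IH].
  by under eq_fun do rewrite big_nil; exact: cvg_cst.
under eq_fun do rewrite big_cons.
exact: (cvgD (cF i u) IH).
Qed.

Lemma continuous_dotv n (f g : U -> 'cV[R]_n) :
  (forall i, continuous (fun u => f u i 0)) ->
  (forall i, continuous (fun u => g u i 0)) ->
  continuous (fun u => dotv (f u) (g u)).
Proof.
move=> cf cg; under eq_fun do rewrite dotvE.
by apply: continuous_rsum => i u; apply: cvgM; [exact: cf|exact: cg].
Qed.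

End continuous_mx.

(** * Quadratics on the Euclidean ball, and a countable dense subset of it *)

Section ball2_theory.
Context {R : realType} {n : nat}.
Implicit Types (u q v : 'cV[R]_n) (S : R).

Lemma ball2E S v : 0 <= S -> ball2 S v <-> dotv v v <= S ^+ 2.
Proof.
move=> S0; rewrite /ball2 /norm2 /= -{1}(ger0_norm S0) -sqrtr_sqr ler_sqrt//.
by rewrite sqr_ge0.
Qed.

(** Follows from the identity [|u + t (q - u)|^2 = (1 - t) |u|^2 + t |q|^2 - t (1 - t) |q - u|^2],
    which spares the Cauchy-Schwarz inequality. *)
Lemma ball2_segment S u q t : 0 <= S -> ball2 S u -> ball2 S q -> 0 <= t <= 1 ->
  ball2 S (u + t *: (q - u)).
Proof.
move=> S0 /(ball2E _ S0) uS /(ball2E _ S0) qS /andP[t0 t1]; apply/ball2E => //.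
have pu := dotv_ge0 (q - u).
have -> : dotv (u + t *: (q - u)) (u + t *: (q - u)) =
    (1 - t) * dotv u u + t * dotv q q - t * (1 - t) * dotv (q - u) (q - u).
  by rewrite !(dotvDr, dotvDl, dotvZr, dotvZl, dotvNr, dotvNl) (dotvC q u); ring.
rewrite (@le_trans _ _ ((1 - t) * dotv u u + t * dotv q q))//.
  by rewrite gerBl !mulr_ge0// subr_ge0.
rewrite (@le_trans _ _ ((1 - t) * S ^+ 2 + t * S ^+ 2))//.
  by rewrite lerD// ler_wpM2l// subr_ge0.
by rewrite -mulrDl subrK mul1r.
Qed.

Lemma quadratic_expand (B : 'M[R]_n) (b a p : 'cV[R]_n) t : B^T = B ->
  dotv b (a + t *: p) + 2^-1 * dotv (a + t *: p) (B *m (a + t *: p)) =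
  dotv b a + 2^-1 * dotv a (B *m a) + t * (dotv b p + dotv a (B *m p))
  + 2^-1 * t ^+ 2 * dotv p (B *m p).
Proof.
move=> Bs; rewrite mulmxDr -scalemxAr !(dotvDr, dotvDl, dotvZr, dotvZl).
by rewrite (dotv_mulmx B p a) Bs (dotvC (B *m p) a); field.
Qed.

(* First-order optimality on a convex set, upgraded by strong convexity. *)
Lemma quadratic_argmin S (B : 'M[R]_n) (c : R) (b th u q : 'cV[R]_n) :
  0 <= S -> B^T = B -> (forall v, 0 <= dotv v (B *m v)) ->
  let Q v := c + dotv b (v - th) + 2^-1 * dotv (v - th) (B *m (v - th)) in
  is_argmin (ball2 S) Q u -> ball2 S q ->
  Q u + 2^-1 * dotv (q - u) (B *m (q - u)) <= Q q.
Proof.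
move=> S0 Bs Bp Q [uS umin] qS.
set p := q - u; set N := dotv p (B *m p).
pose L := dotv b p + dotv (u - th) (B *m p).
have QE t : Q (u + t *: p) = Q u + t * L + 2^-1 * t ^+ 2 * N.
  rewrite /Q (_ : u + t *: p - th = (u - th) + t *: p); last by rewrite addrAC.
  by rewrite -(addrA c) quadratic_expand// -/N -/L !addrA.
have N0 : 0 <= N by exact: Bp.
have L0 : 0 <= L.
  rewrite leNgt; apply/negP => Ln.
  (* With this step size [t N <= - L], so the increment [t (L + t N / 2)] is at most [t L / 2 < 0],
     against minimality. The 1 in [N + 1] guards against [N = 0]. *)
  pose t := Num.min 1 (- L / (N + 1)).
  have N1 : 0 < N + 1 by rewrite ltr_wpDl.
  have t0 : 0 < t by rewrite lt_min ltr01 divr_gt0// oppr_gt0.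
  have t1 : t <= 1 by rewrite ge_min lexx.
  have tN : t * N <= - L.
    rewrite (@le_trans _ _ (t * (N + 1)))//; first by rewrite ler_wpM2l ?ltW ?ltrDl.
    by rewrite -ler_pdivlMr// ge_min lexx orbT.
  have := umin _ (ball2_segment S0 uS qS (introT andP (conj (ltW t0) t1))).
  rewrite QE -addrA lerDl (_ : _ + _ = t * (L + 2^-1 * (t * N))); last by ring.
  rewrite pmulr_rge0// leNgt => /negP; apply.
  move: (t * N) tN => k kL; clear -Ln kL; lra.
have -> : q = u + 1 *: p by rewrite scale1r addrC subrK.
rewrite QE; clear -L0; lra.
Qed.

(** Rounding towards zero: the bound on squares keeps a vector rounded coordinate by coordinate
    inside any centered ball that contains it. *)
Lemma exists_rat_near (x e : R) : 0 < e ->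
  exists q : rat, `|x - ratr q| < e /\ (ratr q : R) ^+ 2 <= x ^+ 2.
Proof.
move=> e0; have [x0|x0|->] := ltgtP x 0; last by exists 0; rewrite rmorph0 subrr normr0.
- have [q] := @rat_in_itvoo R x (Num.min 0 (x + e)) ltac:(by rewrite lt_min x0 ltrDl).
  rewrite in_itv/= lt_min => /and3P[xq q0 qe]; exists q; split.
    by rewrite distrC gtr0_norm ?subr_gt0// ltrBlDl.
  by rewrite -[leLHS]sqrrN -[leRHS]sqrrN ler_sqr ?nnegrE ?oppr_ge0 ?lerN2 ltW.
- have [q] := @rat_in_itvoo R (Num.max 0 (x - e)) x ltac:(by rewrite gt_max x0 gtrBl).
  rewrite in_itv/= gt_max => /andP[/andP[q0 qe] qx]; exists q; split.
    by rewrite gtr0_norm ?subr_gt0// ltrBlDr -ltrBlDl.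
  by rewrite ler_sqr ?nnegrE ltW.
Qed.

(** Boundary points are the difficulty, since a nearby rational vector may fall outside the ball.
    Rounding every coordinate towards zero avoids this. *)
Lemma dense_seq_ball2 S : 0 <= S ->
  exists e : nat -> 'cV[R]_n, (forall k, ball2 S (e k)) /\
    forall u V, ball2 S u -> nbhs u V -> exists k, V (e k).
Proof.
move=> S0.
pose f (q : 'cV[rat]_n) : 'cV[R]_n := map_mx ratr q.
(* Indices that code no rational vector of the ball are sent to 0, which lies in the ball. *)
pose e k : 'cV[R]_n := if unpickle k is Some q then
  (if `[< ball2 S (f q) >] then f q else 0) else 0.
have b0 : ball2 S (0 : 'cV[R]_n).
  by apply/ball2E => //; rewrite /dotv mulmx0 mxE sqr_ge0.
exists e; split=> [k|u V uS].
  by rewrite /e; case: unpickle => // q; case: asboolP.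
move=> /nbhs_ballP[r /= r0 rV].
have [q hq] := choice (fun i => exists_rat_near (u i 0) r0).
pose Q : 'cV[rat]_n := \col_i q i.
have QE i : f Q i 0 = ratr (q i) by rewrite !mxE.
have QS : ball2 S (f Q).
  apply/ball2E => //; apply: le_trans (proj1 (ball2E _ S0) uS).
  rewrite !dotvE; apply: ler_sum => i _; rewrite QE -!expr2.
  by have [] := hq i.
exists (pickle Q); rewrite /e pickleK asboolT//; apply: rV; split => // i j.
by rewrite [j]ord1 QE; have [] := hq i.
Qed.

End ball2_theory.

(* The condition [c <= u w i 0] holds iff for every precision some point of a
   countable dense set, with i-th coordinate almost above c, is almost optimal. *)
Lemma measurable_argmin {R : realType} {d} {T : measurableType d} n (S : R)
    (f : T -> 'cV[R]_n -> R) (kappa : T -> R) (u : T -> 'cV[R]_n) :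
  0 <= S -> (forall q, measurable_fun [set: T] (f^~ q)) ->
  (forall w, continuous (f w)) -> (forall w, 0 < kappa w) ->
  (forall w, is_argmin (ball2 S) (f w) (u w)) ->
  (forall w q, ball2 S q ->
     f w (u w) + kappa w * dotv (q - u w) (q - u w) <= f w q) ->
  measurable_fun [set: T] u.
Proof.
move=> S0 mf cf k0 umin ustrong.
have nlt (g : 'cV[R]_n -> R) (x : 'cV[R]_n) y :
    continuous g -> g x < y -> \forall q \near x, g q < y.
  by move=> cg gy; have /cvgr_lt := cg x; apply.
have ngt (g : 'cV[R]_n -> R) (x : 'cV[R]_n) y :
    continuous g -> y < g x -> \forall q \near x, y < g q.
  by move=> cg gy; have /cvgr_gt := cg x; apply.
have [e [eS edense]] := @dense_seq_ball2 R n S S0.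
apply/measurable_fun_mxP => i j; rewrite [j]ord1.
apply: (measurability (@RGenCInfty.G R)) => [|/= _ [_] [c] -> <-].
  exact: RGenCInfty.measurableE.
rewrite setTI preimage_itvcy.
pose eps (k : nat) : R := k.+1%:R^-1.
have eps0 k : 0 < eps k by rewrite invr_gt0 ltr0n.
have -> : [set w | c <= u w i 0] = \bigcap_(k in [set: nat])
    \bigcup_(l in [set l | c - eps k <= e l i 0]) \bigcap_(h in [set: nat])
      [set w | f w (e l) <= f w (e h) + eps k].
  apply/seteqP; split => [w cw k _|w H].
    have uS : ball2 S (u w) by case: (umin w).
    have : nbhs (u w) [set q : 'cV[R]_n | c - eps k < q i 0 /\ f w q < f w (u w) + eps k].
      apply: filterI.
        apply: (ngt (fun q => q i 0)); first exact: coord_continuous.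
        by rewrite ltrBlDr (le_lt_trans cw)// ltrDl.
      by apply: nlt; [exact: cf|rewrite ltrDl].
    move=> /(edense _ _ uS)[l [cl fl]]; exists l; first exact: ltW.
    move=> h _; apply: ltW; apply: (lt_le_trans fl); rewrite lerD2r.
    by case: (umin w) => _; apply; exact: eS.
  rewrite /= leNgt; apply/negP => uc.
  pose del := c - u w i 0; have del0 : 0 < del by rewrite subr_gt0.
  (* Precision below [del / 2] forces the i-th coordinate of the approximate minimizer to be at
     least [del / 2] above that of [u w]; strong growth then costs [kappa w * (del / 2) ^+ 2], more
     than the precision allows. *)
  have m0 : 0 < Num.min (del / 2) (kappa w * (del / 2) ^+ 2).
    by rewrite lt_min divr_gt0//= mulr_gt0// exprn_gt0// divr_gt0.
  have [k _ /(_ k (leqnn k))] := near_infty_natSinv_lt (PosNum m0).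
  rewrite /= lt_min -/(eps k) => /andP[kd kk].
  have [l /= cl fl] := H k I.
  (* Near-optimality is known only against the dense sequence; continuity of [f w] transfers it to
     the minimizer itself. *)
  have fle : f w (e l) <= f w (u w) + eps k.
    rewrite leNgt; apply/negP => fgt.
    have uS : ball2 S (u w) by case: (umin w).
    have : nbhs (u w) [set q : 'cV[R]_n | f w q < f w (e l) - eps k].
      by apply: nlt; [exact: cf|rewrite ltrBrDr].
    move=> /(edense _ _ uS)[h /=]; rewrite ltrBrDr ltNge => /negP; apply.
    exact: fl.
  have := ustrong w (e l) (eS l).
  rewrite leNgt => /negP; apply; apply: (le_lt_trans fle); rewrite ltrD2l.
  apply: (lt_le_trans kk); rewrite ler_pM2l//.
  have dl : del / 2 <= (e l - u w) i 0.
    rewrite !mxE lerBrDr; apply: le_trans cl.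
    have aux (a b r : R) : a < (r - b) / 2 -> (r - b) / 2 + b <= r - a by clear; lra.
    exact: aux kd.
  rewrite dotvE (bigD1 i)//= -expr2 (@le_trans _ _ ((e l - u w) i 0 ^+ 2))//.
    rewrite ler_sqr// nnegrE ?(le_trans _ dl)//; first by rewrite divr_ge0// ltW.
    by rewrite divr_ge0// ltW.
  by rewrite lerDl; apply: sumr_ge0 => h _; rewrite -expr2 sqr_ge0.
apply: bigcap_measurable => [|k _]; first by exists 0%N.
apply: bigcup_measurable => l _.
apply: bigcap_measurable => [|h _]; first by exists 0%N.
rewrite -[X in measurable X]setTI.
apply: (measurable_fun_ler _ _ measurableT (Y := [set true])) => //.
by apply: measurable_funD => //.
Qed.

Section omd.
Context {R : realType} {n : nat}.
Variables (m g : R -> R) (tau : R).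
Hypotheses (cm : convex_function [set: convex_lmodType R^o] m) (hm : C3 m)
  (g0 : 0 < g tau).

Lemma normM_sqr (M : 'M[R]_n) v : 0 <= dotv v (M *m v) ->
  normM M v ^+ 2 = dotv v (M *m v).
Proof. by move=> ?; rewrite sqr_sqrtr. Qed.

Lemma dotv_outer (x v : 'cV[R]_n) : dotv v ((x *m x^T) *m v) = dotv x v ^+ 2.
Proof.
rewrite -mulmxA [x^T *m v]mx11_scalar -/(dotv x v) mul_mx_scalar dotvZr dotvC.
by rewrite expr2.
Qed.

Lemma hess_glm_loss_sym (x : 'cV[R]_n) r v :
  (hess (glm_loss m g tau x r) v)^T = hess (glm_loss m g tau x r) v.
Proof. by rewrite hess_glm_loss// linearZ/= trmx_mul trmxK. Qed.

Lemma hess_glm_loss_ge0 (x : 'cV[R]_n) r v u :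
  0 <= dotv u (hess (glm_loss m g tau x r) v *m u).
Proof.
rewrite hess_glm_loss// -scalemxAl dotvZr dotv_outer mulr_ge0 ?sqr_ge0//.
by rewrite divr_ge0 ?(ltW g0)//; exact: convex_derive2_ge0.
Qed.

Variables (S lambda gamma eta : R) (theta1 : 'cV[R]_n).
Hypotheses (S0 : 0 <= S) (lambda0 : 0 < lambda) (gamma01 : 0 < gamma < 1)
  (eta0 : 0 < eta).

(** Every round injects a fresh [(1 - gamma) lambda I] and the Hessians of the convex losses are
    positive semidefinite, so the lower bound does not decay with [t]. *)
Lemma omd_A_ge (x : nat -> 'cV[R]_n) (r : nat -> R) theta H A :
  discounted_omd S lambda gamma eta theta1
    (fun t => glm_loss m g tau (x t) (r t)) theta H A ->
  forall t, (1 <= t)%N -> (A t)^T = A t /\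
    forall v, (1 - gamma) * lambda * dotv v v <= dotv v (A t *m v).
Proof.
have /andP[gamma0 gamma1] := gamma01.
move=> [_ H1 rec].
(* Semidefiniteness of [H t] yields the bound on [A t], which returns semidefiniteness of [H t.+1];
   the induction therefore runs on [H]. *)
have AH t : (1 <= t)%N -> (H t)^T = H t /\ (forall v, 0 <= dotv v (H t *m v)) ->
    (A t)^T = A t /\
    forall v, (1 - gamma) * lambda * dotv v v <= dotv v (A t *m v).
  move=> t1 [Hs Hp]; have [-> _ _] := rec t t1; split=> [|v].
    by rewrite linearD/= !linearZ/= Hs tr_scalar_mx.
  rewrite mulmxDl -!scalemxAl mul_scalar_mx dotvDr !dotvZr mulrA lerDr.
  by rewrite mulr_ge0// ltW.
suff HH t : (1 <= t)%N -> (H t)^T = H t /\ (forall v, 0 <= dotv v (H t *m v)).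
  by move=> t t1; exact: AH (HH _ t1).
elim: t => // -[_ _|t IH _].
  rewrite H1 tr_scalar_mx; split => // v.
  by rewrite mul_scalar_mx dotvZr mulr_ge0 ?dotv_ge0// ltW.
have [As Ap] := AH t.+1 isT (IH isT).
have [_ _ ->] := rec t.+1 isT.
split=> [|v]; first by rewrite linearD/= As hess_glm_loss_sym.
rewrite mulmxDl dotvDr addr_ge0 ?hess_glm_loss_ge0//.
by apply: le_trans (Ap v); rewrite !mulr_ge0 ?dotv_ge0 ?subr_ge0// ltW.
Qed.

Lemma omd_A_posdef (x : nat -> 'cV[R]_n) (r : nat -> R) theta H A :
  discounted_omd S lambda gamma eta theta1
    (fun t => glm_loss m g tau (x t) (r t)) theta H A ->
  forall t, (1 <= t)%N -> posdef (A t).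
Proof.
have /andP[gamma0 gamma1] := gamma01.
move=> /omd_A_ge h t /h[As Ap]; split => // v v0; apply: lt_le_trans (Ap v).
by rewrite !mulr_gt0 ?dotv_gt0 ?subr_gt0.
Qed.

Context {d} {T : measurableType d}.

Lemma measurable_C3 (f : T -> R) : measurable_fun [set: T] f ->
  [/\ measurable_fun [set: T] (fun w => m (f w)),
      measurable_fun [set: T] (fun w => derive1 m (f w)) &
      measurable_fun [set: T] (fun w => derive1 (derive1 m) (f w))].
Proof.
have c0 : continuous m.
  apply: derivable_continuous => z; have [h _ _] := C3_derivable z hm; exact: h.
have c1 : continuous (derive1 m).
  apply: derivable_continuous => z; have [_ h _] := C3_derivable z hm; exact: h.
have c2 : continuous (derive1 (derive1 m)).
  apply: derivable_continuous => z; have [_ _ h] := C3_derivable z hm; exact: h.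
move=> mf; split.
- exact: (measurableT_comp (continuous_measurable_fun c0) mf).
- exact: (measurableT_comp (continuous_measurable_fun c1) mf).
- exact: (measurableT_comp (continuous_measurable_fun c2) mf).
Qed.

Lemma measurable_glm_loss (x v : T -> 'cV[R]_n) (r : T -> R) :
  measurable_fun [set: T] x -> measurable_fun [set: T] r ->
  measurable_fun [set: T] v ->
  measurable_fun [set: T] (fun w => glm_loss m g tau (x w) (r w) (v w)).
Proof.
move=> mx mr mv; have mxv := measurable_dotv mx mv.
have [m0 _ _] := measurable_C3 mxv.
apply: measurable_funM => //; apply: measurable_funB => //.
exact: measurable_funM.
Qed.

Lemma measurable_grad_glm_loss (x v : T -> 'cV[R]_n) (r : T -> R) :
  measurable_fun [set: T] x -> measurable_fun [set: T] r ->
  measurable_fun [set: T] v ->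
  measurable_fun [set: T] (fun w => grad (glm_loss m g tau (x w) (r w)) (v w)).
Proof.
move=> mx mr mv; have mxv := measurable_dotv mx mv.
have [_ m1 _] := measurable_C3 mxv.
under eq_fun do rewrite grad_glm_loss//.
apply: measurable_scalemx => //; apply: measurable_funM => //.
exact: measurable_funB.
Qed.

Lemma measurable_hess_glm_loss (x v : T -> 'cV[R]_n) (r : T -> R) :
  measurable_fun [set: T] x -> measurable_fun [set: T] v ->
  measurable_fun [set: T] (fun w => hess (glm_loss m g tau (x w) (r w)) (v w)).
Proof.
move=> mx mv; have mxv := measurable_dotv mx mv.
have [_ _ m2] := measurable_C3 mxv.
under eq_fun do rewrite hess_glm_loss//.
apply: measurable_scalemx; first exact: measurable_funM.
by apply: measurable_mulmx => //; exact: measurable_trmx.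
Qed.

Variables (x theta : nat -> T -> 'cV[R]_n) (r : nat -> T -> R)
  (H A : nat -> T -> 'M[R]_n).
Hypothesis homd : forall w, discounted_omd S lambda gamma eta theta1
    (fun t => glm_loss m g tau (x t w) (r t w))
    (fun t => theta t w) (fun t => H t w) (fun t => A t w).

Lemma measurable_omd_A t : (1 <= t)%N -> measurable_fun [set: T] (H t) ->
  measurable_fun [set: T] (A t).
Proof.
move=> t1 mH.
rewrite (_ : A t = fun w => gamma *: H t w + (1 - gamma) *: lambda%:M); last first.
  by apply/funext => w; have [_ _ /(_ t t1)[]] := homd w.
by apply: measurable_addmx => //; exact: measurable_scalemx.
Qed.

(** Over the space [Omega] with the sigma-algebra of the history as [T], this says that the iterates
    are functions of the past. The recursion only specifies [theta t.+1] as some minimizer, and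
    strong convexity pins it down. *)
Lemma measurable_omd t : (1 <= t)%N ->
  (forall s, (1 <= s < t)%N ->
     measurable_fun [set: T] (x s) /\ measurable_fun [set: T] (r s)) ->
  measurable_fun [set: T] (theta t) /\ measurable_fun [set: T] (H t).
Proof.
have /andP[gamma0 gamma1] := gamma01.
elim: t => // -[_ _ _|t IH _ mxr].
  split; [rewrite (_ : theta 1%N = cst theta1)//|rewrite (_ : H 1%N = cst lambda%:M)//];
    by apply/funext => w; have [] := homd w.
have [|mth mH] := IH isT.
  by move=> s /andP[s1 st]; apply: mxr; rewrite s1 ltnW.
have [mx mr] := mxr t.+1 (ltnSn _).
have mA := measurable_omd_A (ltn0Sn t) mH.
(* The iterate must come before the matrix, because [H t.+2] uses the Hessian at the new iterate. *)
suff mth' : measurable_fun [set: T] (theta t.+2).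
  split => //.
  rewrite (_ : H t.+2 = fun w => A t.+1 w +
      hess (glm_loss m g tau (x t.+1 w) (r t.+1 w)) (theta t.+2 w)); last first.
    by apply/funext => w; have [_ _ /(_ t.+1 isT)[]] := homd w.
  by apply: measurable_addmx => //; exact: measurable_hess_glm_loss.
pose l w := glm_loss m g tau (x t.+1 w) (r t.+1 w).
pose th w := theta t.+1 w.
(* The Taylor term and the proximal term [(2 eta)^-1 |v - th|_A^2] merge into one quadratic with
   matrix [B]. *)
pose B w := hess (l w) (th w) + eta^-1 *: A t.+1 w.
pose Q w v := l w (th w) + dotv (grad (l w) (th w)) (v - th w)
  + 2^-1 * dotv (v - th w) (B w *m (v - th w)).
have Age w := omd_A_ge (homd w) (ltn0Sn t).
have k0 : 0 < (1 - gamma) * lambda by rewrite mulr_gt0// subr_gt0.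
have BE w v : dotv v (B w *m v) =
    dotv v (hess (l w) (th w) *m v) + eta^-1 * dotv v (A t.+1 w *m v).
  by rewrite mulmxDl dotvDr -scalemxAl dotvZr.
have A0 w v : 0 <= dotv v (A t.+1 w *m v).
  by apply: le_trans (proj2 (Age w) v); rewrite mulr_ge0 ?dotv_ge0// ltW.
have B0 w v : 0 <= dotv v (B w *m v).
  by rewrite BE addr_ge0 ?hess_glm_loss_ge0// mulr_ge0// invr_ge0 ltW.
have Qmin w : is_argmin (ball2 S) (Q w) (theta t.+2 w).
  have [_ _ /(_ t.+1 isT)[_ hmin _]] := homd w.
  rewrite (_ : Q w = fun v => taylor2 (l w) (th w) v
    + (2 * eta)^-1 * normM (A t.+1 w) (v - th w) ^+ 2)//.
  apply/funext => v; rewrite /Q /taylor2 !normM_sqr ?hess_glm_loss_ge0// BE.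
  by rewrite mulrDr !addrA invfM mulrA.
(* The growth constant is half of the lower bound [eta^-1 (1 - gamma) lambda] on [B], inherited from
   [omd_A_ge]. *)
apply: (@measurable_argmin _ _ _ _ S Q
  (fun=> 2^-1 * (eta^-1 * ((1 - gamma) * lambda)))) => //.
- move=> q.
  have mq : measurable_fun [set: T] (fun w => q - th w) by exact: measurable_submx.
  apply: measurable_funD; first apply: measurable_funD.
  + exact: measurable_glm_loss.
  + by apply: measurable_dotv => //; exact: measurable_grad_glm_loss.
  + apply: measurable_funM => //; apply: measurable_dotv => //.
    apply: measurable_mulmx => //; apply: measurable_addmx.
      exact: measurable_hess_glm_loss.
    exact: measurable_scalemx.
- move=> w.
  have c1 i : continuous (fun v : 'cV[R]_n => (v - th w) i 0).
    rewrite (_ : (fun v => _) = fun v : 'cV[R]_n => v i 0 - th w i 0); last first.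
      by apply/funext => v; rewrite !mxE.
    have ci : continuous (fun v : 'cV[R]_n => v i 0) by exact: coord_continuous.
    by move=> v; exact: (cvgB (ci v) (cvg_cst _)).
  have c2 i : continuous (fun v : 'cV[R]_n => (B w *m (v - th w)) i 0).
    under eq_fun do rewrite mxE.
    by apply: continuous_rsum => j v; exact: (cvgM (cvg_cst _) (c1 j v)).
  have c3 : continuous (fun v : 'cV[R]_n => dotv (grad (l w) (th w)) (v - th w)).
    by apply: continuous_dotv => // i; exact: cst_continuous.
  have c4 : continuous (fun v : 'cV[R]_n => dotv (v - th w) (B w *m (v - th w))).
    exact: continuous_dotv.
  by move=> v; exact: (cvgD (cvgD (cvg_cst _) (c3 v)) (cvgM (cvg_cst _) (c4 v))).
- by move=> w; rewrite !mulr_gt0// ?invr_gt0// subr_gt0.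
- move=> w q qS; apply: le_trans (quadratic_argmin S0 _ (B0 w) (Qmin w) qS).
    rewrite lerD2l -mulrA ler_wpM2l// BE -[leLHS]add0r lerD ?hess_glm_loss_ge0//.
    by rewrite -mulrA ler_wpM2l ?invr_ge0 ?(ltW eta0)//; exact: (proj2 (Age w)).
  by rewrite linearD/= linearZ/= (proj1 (Age w)) hess_glm_loss_sym.
Qed.

End omd.

(** * The exponential moment of the discounted sum *)

Section glm_model.
Context {R : realType} {n : nat}.
Variables (m g : R -> R) (h : R -> R -> R) (tau : R)
  (nu : {sigma_finite_measure set R -> \bar R}).
Hypotheses (hm : C3 m)
  (hh : measurable_fun [set: R] (fun r => h r tau))
  (hpdf : forall z, (\int[nu]_r (glm_pdf m g h tau z r)%:E = 1)%E).

Local Notation loss x r := (glm_loss m g tau x r).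

Lemma measurable_glm_pdf {d} {T : measurableType d} (z y : T -> R) :
  measurable_fun [set: T] z -> measurable_fun [set: T] y ->
  measurable_fun [set: T] (fun w => glm_pdf m g h tau (z w) (y w)).
Proof.
move=> mz my; have [mmz _ _] := measurable_C3 hm mz.
apply: measurableT_comp => //; apply: measurable_funD.
  apply: measurable_funM => //; apply: measurable_funB => //.
  exact: measurable_funM.
exact: (measurableT_comp hh my).
Qed.

(** Together with [expR_Nloss]: up to the factor [expR (h y tau)], which is free of the parameter,
    the loss is the negative log-likelihood. *)
Lemma expR_loss_glm_pdf (x v : 'cV[R]_n) y :
  expR (loss x y v) * glm_pdf m g h tau (dotv x v) y = expR (h y tau).
Proof. by rewrite -expRD addrA -mulrDl -opprB addNr mul0r add0r. Qed.

Lemma expR_Nloss (x v : 'cV[R]_n) y :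
  expR (- loss x y v) * expR (h y tau) = glm_pdf m g h tau (dotv x v) y.
Proof. by rewrite -expRD -mulNr opprB. Qed.

(** Here the measure itself depends on [w]. Moving that dependence into a density against Lebesgue
    measure gives a jointly measurable integrand, to which Tonelli applies. *)
Lemma measurable_mix_integral {d} {T : measurableType d}
    (x c : T -> 'cV[R]_n) (K : T -> 'M[R]_n) (y : T -> R) :
  measurable_fun [set: T] x -> measurable_fun [set: T] c ->
  measurable_fun [set: T] K -> measurable_fun [set: T] y ->
  (forall w, posdef (K w)) ->
  measurable_fun [set: T] (fun w =>
    \int[gaussian_prob (c w) (invmx (K w))]_v (expR (- loss (x w) (y w) v))%:E)%E.
Proof.
move=> mx mc mK my Kp; have [mu muE] := @lebesgue_cV_sigma_finite R n.
pose F (p : T * 'cV[R]_n) : R := expR (- loss (x p.1) (y p.1) p.2) *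
  (Num.sqrt (\det (K p.1) / (2 * pi) ^+ n) *
   expR (- (dotv (p.2 - c p.1) (K p.1 *m (p.2 - c p.1)) / 2))).
have mF : measurable_fun [set: T * 'cV[R]_n] (EFin \o F).
  have m1 := @measurable_fst _ _ T 'cV[R]_n.
  have m2 := @measurable_snd _ _ T 'cV[R]_n.
  have mx1 := measurableT_comp mx m1; have mc1 := measurableT_comp mc m1.
  have mK1 := measurableT_comp mK m1; have my1 := measurableT_comp my m1.
  have msub := measurable_submx m2 mc1.
  apply/measurable_EFinP; apply: measurable_funM.
    apply: measurableT_comp => //; apply: measurable_funN.
    exact: (measurable_glm_loss g tau hm mx1 my1 m2).
  apply: measurable_funM.
    apply: measurableT_comp.
      by apply: continuous_measurable_fun => r; exact: sqrt_continuous.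
    by apply: measurable_funM => //; exact: (measurable_det mK1).
  apply: measurableT_comp => //; apply: measurable_funN; apply: measurable_funM => //.
  exact: measurable_dotv msub (measurable_mulmx mK1 msub).
have F0 p : (0 <= (EFin \o F) p)%E.
  by rewrite lee_fin !mulr_ge0 ?expR_ge0 ?sqrtr_ge0.
have := @measurable_fun_fubini_tonelli_F _ _ _ _ R mu (EFin \o F) mF F0.
congr (measurable_fun _ _); apply/funext => w.
rewrite integral_gaussian_prob//; last first.
  apply/measurable_EFinP; apply: measurableT_comp => //; apply: measurable_funN.
  by apply: (measurable_glm_loss g tau hm (x := cst (x w)) (r := cst (y w))).
rewrite muE; apply: eq_integral => v _.
by rewrite /= -EFinM gaussian_pdfE.
Qed.

(** With the past frozen, the integrand is the mixture density [y -> E_v p(y | x . v)]. Tonelli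
    integrates [y] first, where each [v] contributes 1, and the Gaussian has mass 1. *)
Lemma integral_mix_ratio (x c u : 'cV[R]_n) (K : 'M[R]_n) : posdef K ->
  (\int[nu]_y ((expR (loss x y u))%:E *
     \int[gaussian_prob c (invmx K)]_v (expR (- loss x y v))%:E *
     (glm_pdf m g h tau (dotv x u) y)%:E) = 1)%E.
Proof.
move=> Kp; have [mu muE] := @lebesgue_cV_sigma_finite R n.
pose F (p : R * 'cV[R]_n) : R := glm_pdf m g h tau (dotv x p.2) p.1 *
  gaussian_pdf c (invmx K) p.2.
have mpdf := measurable_gaussian_pdf c Kp.
have pdf0 := gaussian_pdf_gt0 c Kp.
have mF : measurable_fun [set: R * 'cV[R]_n] (EFin \o F).
  apply/measurable_EFinP; apply: measurable_funM.
    apply: measurable_glm_pdf => //.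
    by apply: measurable_dotv => //; exact: measurable_snd.
  exact: (measurableT_comp mpdf (@measurable_snd _ _ R 'cV[R]_n)).
have F0 p : (0 <= (EFin \o F) p)%E by rewrite lee_fin mulr_ge0 ?expR_ge0 ?ltW.
transitivity (\int[nu]_y \int[mu]_v (EFin \o F) (y, v))%E.
  apply: eq_integral => y _.
  rewrite integral_gaussian_prob//; last first.
    apply/measurable_EFinP; apply: measurableT_comp => //; apply: measurable_funN.
    by apply: (measurable_glm_loss g tau hm (x := cst x) (r := cst y)).
  (* The comparator [u] disappears here: its loss and its density collapse to [expR (h y tau)],
     which rebuilds the density at [v] out of [expR (- loss)]. *)
  rewrite muE muleAC -EFinM expR_loss_glm_pdf -ge0_integralZl.
  - apply: eq_integral => v _; rewrite -!EFinM mulrA; congr (_ * _)%:E.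
    by rewrite mulrC expR_Nloss.
  - exact: measurableT.
  - apply/measurable_EFinP; apply: measurable_funM => //.
    apply: measurableT_comp => //; apply: measurable_funN.
    by apply: (measurable_glm_loss g tau hm (x := cst x) (r := cst y)).
  - by move=> v _; rewrite lee_fin mulr_ge0 ?expR_ge0 ?ltW.
  - by rewrite lee_fin expR_ge0.
rewrite (fubini_tonelli _ mF F0) -[RHS](integral_gaussian_pdf c Kp) muE.
apply: eq_integral => v _; rewrite /F /=.
under eq_integral do rewrite EFinM.
rewrite ge0_integralZr//; last 3 first.
- by apply/measurable_EFinP; exact: measurable_glm_pdf.
- by move=> y _; rewrite lee_fin expR_ge0.
- by rewrite lee_fin ltW.
by rewrite hpdf mul1e.
Qed.

(* The inequality, rather than an equality, because [fine] and [ln] return junk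
   when [I] is infinite. *)
Lemma expR_ln_fine_le (a : R) (I : \bar R) : (0 < I)%E ->
  ((expR (a + ln (fine I)))%:E <= (expR a)%:E * I)%E.
Proof.
case: I => [s| |]//= s0.
  by rewrite expRD lnK ?posrE -?lte_fin.
by rewrite mulry gtr0_sg ?expR_gt0// mul1e leey.
Qed.

Lemma measurable_gap {d} {T : measurableType d} (x c u : T -> 'cV[R]_n)
    (K : T -> 'M[R]_n) (y : T -> R) :
  measurable_fun [set: T] x -> measurable_fun [set: T] c ->
  measurable_fun [set: T] u -> measurable_fun [set: T] K ->
  measurable_fun [set: T] y -> (forall w, posdef (K w)) ->
  measurable_fun [set: T] (fun w => loss (x w) (y w) (u w)
    - mix_loss (gaussian_prob (c w) (invmx (K w))) (loss (x w) (y w))).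
Proof.
move=> mx mc mu mK my Kp; apply: measurable_funB.
  exact: (measurable_glm_loss g tau hm mx my mu).
rewrite /mix_loss; apply: measurable_funN; apply: measurableT_comp => //.
by apply: measurableT_comp => //; exact: (measurable_mix_integral mx mc mK my Kp).
Qed.

Section one_round.
Context {disp : measure_display} {Omega : measurableType disp}.
Variables (P : probability Omega R) (G0 : set (set Omega)).
Local Notation GT := (g_sigma_algebraType G0).
Hypothesis G0m : <<s G0 >> `<=` (measurable : set (set Omega)).
Variables (Y : Omega -> R) (x c u : GT -> 'cV[R]_n) (K : GT -> 'M[R]_n) (V : GT -> R).
Hypotheses (mY : measurable_fun [set: Omega] Y) (mx : measurable_fun [set: GT] x)
  (mc : measurable_fun [set: GT] c) (mu : measurable_fun [set: GT] u)
  (mK : measurable_fun [set: GT] K) (mV : measurable_fun [set: GT] V)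
  (Kp : forall w, posdef (K w))
  (law : has_cond_density P <<s G0 >> Y nu
     (fun w => glm_pdf m g h tau (dotv (x w) (u w)))).

(** [V] carries what earlier rounds contribute. Being a function of the past, it leaves the integral
    over the reward, and the remaining ratio integrates to 1 by [integral_mix_ratio]. *)
Lemma one_round_le :
  (\int[P]_w (expR (V w + (loss (x w) (Y w) (u w)
      - mix_loss (gaussian_prob (c w) (invmx (K w))) (loss (x w) (Y w)))))%:E
   <= \int[P]_w (expR (V w))%:E)%E.
Proof.
pose I (p : GT * R) := (\int[gaussian_prob (c p.1) (invmx (K p.1))]_v
  (expR (- loss (x p.1) p.2 v))%:E)%E.
have m1 := @measurable_fst _ _ GT R; have m2 := @measurable_snd _ _ GT R.
have mx1 := measurableT_comp mx m1; have mc1 := measurableT_comp mc m1.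
have mK1 := measurableT_comp mK m1; have mu1 := measurableT_comp mu m1.
have mV1 := measurableT_comp mV m1.
have mI : measurable_fun [set: GT * R] I.
  exact: (measurable_mix_integral mx1 mc1 mK1 m2 (fun p => Kp p.1)).
have ml : measurable_fun [set: GT * R] (fun p => loss (x p.1) p.2 (u p.1)).
  exact: (measurable_glm_loss g tau hm mx1 m2 mu1).
have I0 p : (0 < I p)%E.
  apply: integral_gaussian_prob_gt0 => // [|v]; last exact: expR_gt0.
  apply: measurableT_comp => //; apply: measurable_funN.
  by apply: (measurable_glm_loss g tau hm (x := cst (x p.1)) (r := cst p.2)).
(* The extended-real version of the integrand, with [I] itself instead of [ln (fine I)]; it
   dominates the original even where [I] is infinite. *)
pose phi (p : GT * R) := ((expR (V p.1))%:E *
  ((expR (loss (x p.1) p.2 (u p.1)))%:E * I p))%E.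
have mphi : measurable_fun [set: GT * R] phi.
  apply: emeasurable_funM.
    by apply/measurable_EFinP; apply: measurableT_comp => //; exact: mV1.
  apply: emeasurable_funM => //.
  by apply/measurable_EFinP; apply: measurableT_comp => //; exact: ml.
have phi0 p : (0 <= phi p)%E.
  by rewrite /phi !mule_ge0 ?lee_fin ?expR_ge0// ltW.
have mid : measurable_fun [set: Omega] (id : Omega -> GT).
  exact: measurable_id_sub.
have mpair : measurable_fun [set: Omega] (fun w => (w : GT, Y w)).
  exact: measurable_fun_pair.
have mf : measurable_fun [set: GT * R]
    (fun p : GT * R => glm_pdf m g h tau (dotv (x p.1) (u p.1)) p.2).
  by apply: measurable_glm_pdf => //; exact: (measurable_dotv mx1 mu1).
have f0 w y : 0 <= glm_pdf m g h tau (dotv (x w) (u w)) y by exact: expR_ge0.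
apply: (@le_trans _ _ (\int[P]_w phi (w : GT, Y w))%E).
  apply: ge0_le_integral.
  - exact: measurableT.
  - by move=> w _; rewrite lee_fin expR_ge0.
  - apply/measurable_EFinP; apply: (measurableT_comp (@measurable_expR R)).
    apply: measurable_funD; first exact: measurableT_comp mV mid.
    exact: (measurableT_comp (measurable_gap mx1 mc1 mu1 mK1 m2 (fun p => Kp p.1)) mpair).
  - exact: measurableT_comp mphi mpair.
  - move=> w _; rewrite /phi expRD EFinM; apply: lee_wpmul2l.
      by rewrite lee_fin expR_ge0.
    by rewrite /mix_loss opprK; exact: (expR_ln_fine_le _ (I0 (w, Y w))).
rewrite (integral_cond_density G0m mY mf f0 law mphi phi0).
rewrite [leLHS](_ : _ = \int[P]_w (expR (V w))%:E)%E//; apply: eq_integral => w _.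
have -> : (fun y => phi (w : GT, y) * (glm_pdf m g h tau (dotv (x w) (u w)) y)%:E)%E =
  (fun y => (expR (V w))%:E * ((expR (loss (x w) y (u w)))%:E * I (w, y) *
    (glm_pdf m g h tau (dotv (x w) (u w)) y)%:E))%E.
  by apply/funext => y; rewrite /phi !muleA.
rewrite ge0_integralZl; last by rewrite lee_fin expR_ge0.
- by rewrite (integral_mix_ratio (x w) (c w) (u w) (Kp w)) mule1.
- exact: measurableT.
- have mp : measurable_fun [set: R] (fun y => (w : GT, y)) by exact: measurable_fun_pair.
  apply: emeasurable_funM.
    apply: emeasurable_funM; last exact: (measurableT_comp mI mp).
    by apply/measurable_EFinP; apply: measurableT_comp => //; exact: (measurableT_comp ml mp).
  by apply/measurable_EFinP; exact: (measurableT_comp mf mp).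
- by move=> y _; rewrite !mule_ge0 ?lee_fin ?expR_ge0// ltW.
Qed.

End one_round.

End glm_model.

(** Markov's inequality for an arbitrary measure, since it serves both for the final tail bound and
    for the reference measure [nu]. *)
Lemma mul_measure_ge_le_integral {d} {T : measurableType d} {R : realType}
    (mu : {measure set T -> \bar R}) (f : T -> R) (e : R) :
  measurable_fun [set: T] f -> (forall x, 0 <= f x) -> 0 < e ->
  (e%:E * mu [set x | (e <= f x)%R] <= \int[mu]_x (f x)%:E)%E.
Proof.
move=> mf f0 e0.
have mA : measurable [set x | e <= f x].
  rewrite -[X in measurable X]setTI -preimage_itvcy.
  by apply: mf => //; exact: measurable_itv.
rewrite -[X in mu X]setIT -integral_indic// -ge0_integralZl//.
- apply: ge0_le_integral => //.
  + by move=> x _; rewrite -EFinM lee_fin mulr_ge0// ltW.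
  + by apply: emeasurable_funM => //; apply/measurable_EFinP.
  + exact/measurable_EFinP.
  + move=> x _; rewrite -EFinM lee_fin indicE.
    by have [/set_mem|_] := boolP (x \in _); rewrite ?mulr1 ?mulr0.
- by apply/measurable_EFinP.
- by rewrite lee_fin ltW.
Qed.

Lemma sigma_finite_bundle {d} {T : measurableType d} {R : realType}
    (mu : {measure set T -> \bar R}) : sigma_finite setT mu ->
  exists nu : {sigma_finite_measure set T -> \bar R},
    (mu : set T -> \bar R) = nu.
Proof.
case: mu => f c sf; pose m : {measure set T -> \bar R} := Measure.Pack c.
by exists (HB.pack_for {sigma_finite_measure set T -> \bar R}
  (m : set T -> \bar R) (Measure.class m) (Measure_isSigmaFinite.Build _ _ _ m sf)).
Qed.

(** The sets where [f] is at least [1 / (k + 1)] exhaust the space because [f] is positive, and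
    Markov's inequality bounds the measure of each by [k + 1]. *)
Lemma sigma_finite_of_pdf {d} {T : measurableType d} {R : realType}
    (mu : {measure set T -> \bar R}) (f : T -> R) :
  measurable_fun [set: T] f -> (forall x, 0 < f x) ->
  (\int[mu]_x (f x)%:E = 1)%E -> sigma_finite setT mu.
Proof.
move=> mf f0 f1; exists (fun k => [set x | k.+1%:R^-1 <= f x]).
  apply/seteqP; split => // x _.
  have [k _ /(_ k (leqnn k)) kf] := near_infty_natSinv_lt (PosNum (f0 x)).
  by exists k => //; exact: ltW.
move=> k; split.
  rewrite -[X in measurable X]setTI -preimage_itvcy.
  by apply: mf => //; exact: measurable_itv.
have k0 : 0 < (k.+1%:R^-1 : R) by rewrite invr_gt0 ltr0n.
have := mul_measure_ge_le_integral mu mf (fun x => ltW (f0 x)) k0.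
rewrite f1; case: (mu _) => [s _|/=|//]; first by rewrite ltry.
by rewrite gt0_muley ?lte_fin.
Qed.

(** * The sigma-algebra of the past *)

Section history_theory.
Context {R : realType} {disp : measure_display} {Omega : measurableType disp}.
Variables (n : nat) (x : nat -> Omega -> 'cV[R]_n) (r : nat -> Omega -> R)
  (u : nat -> Omega -> 'cV[R]_n).

(** The generators of [history] before closure, as [g_sigma_algebraType] expects them;
    [<<s history_gen t >>] is [history] by conversion. *)
Definition history_gen t : set (set Omega) :=
  \bigcup_(s in [set s | (1 <= s <= t)%N]) preimage_set_system setT (x s) measurable
  `|` \bigcup_(s in [set s | (1 <= s < t)%N]) preimage_set_system setT (r s) measurable
  `|` \bigcup_(s in [set s | (1 <= s)%N]) preimage_set_system setT (u s) measurable.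

Local Notation HT t := (g_sigma_algebraType (history_gen t)).

Lemma measurable_history_x s t : (1 <= s <= t)%N ->
  measurable_fun [set: HT t] (x s : HT t -> _).
Proof.
move=> st _ B mB; apply: sub_sigma_algebra; left; left; exists s => //.
by exists B.
Qed.

Lemma measurable_history_r s t : (1 <= s < t)%N ->
  measurable_fun [set: HT t] (r s : HT t -> _).
Proof.
move=> st _ B mB; apply: sub_sigma_algebra; left; right; exists s => //.
by exists B.
Qed.

Lemma measurable_history_u s t : (1 <= s)%N ->
  measurable_fun [set: HT t] (u s : HT t -> _).
Proof.
move=> st _ B mB; apply: sub_sigma_algebra; right; exists s => //.
by exists B.
Qed.

Lemma history_sub_measurable t :
  (forall s, (1 <= s)%N -> measurable_fun [set: Omega] (x s)) ->
  (forall s, (1 <= s)%N -> measurable_fun [set: Omega] (r s)) ->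
  (forall s, (1 <= s)%N -> measurable_fun [set: Omega] (u s)) ->
  <<s history_gen t >> `<=` (measurable : set (set Omega)).
Proof.
move=> mx mr mu; apply: smallest_sub; first exact: sigma_algebra_measurable.
move=> B [[] |] [s /= st] [C mC <-].
- by apply: mx => //; case/andP: st.
- by apply: mr => //; case/andP: st.
- by apply: mu.
Qed.

End history_theory.

(** * Measurability of the discounted sum *)

Section discounted_gap.
Context {R : realType} {n : nat}.
Variables (m g : R -> R) (tau : R).
Hypotheses (cm : convex_function [set: convex_lmodType R^o] m) (hm : C3 m)
  (g0 : 0 < g tau).
Variables (S lambda gamma eta alpha : R) (theta1 : 'cV[R]_n).
Hypotheses (S0 : 0 <= S) (lambda0 : 0 < lambda) (gamma01 : 0 < gamma < 1)
  (eta0 : 0 < eta) (alpha0 : 0 < alpha).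

Context {d} {T : measurableType d}.
Variables (x theta u : nat -> T -> 'cV[R]_n) (r : nat -> T -> R)
  (H A : nat -> T -> 'M[R]_n).
Hypothesis homd : forall w, discounted_omd S lambda gamma eta theta1
    (fun t => glm_loss m g tau (x t w) (r t w))
    (fun t => theta t w) (fun t => H t w) (fun t => A t w).

Lemma posdef_precision s w : (1 <= s)%N -> posdef (alpha^-1 *: A s w).
Proof.
move=> s1; apply: posdefZ; first by rewrite invr_gt0.
exact: (omd_A_posdef cm hm g0 lambda0 gamma01 (homd w)).
Qed.

Lemma covariance_precision s w : (1 <= s)%N ->
  alpha *: invmx (A s w) = invmx (alpha^-1 *: A s w).
Proof.
by move=> s1; rewrite invmxZ ?invrK// posdef_unitmx//; exact: posdef_precision.
Qed.

Lemma measurable_discounted_gap t : (1 <= t)%N ->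
  (forall s, (1 <= s < t)%N -> [/\ measurable_fun [set: T] (x s),
     measurable_fun [set: T] (r s) & measurable_fun [set: T] (u s)]) ->
  measurable_fun [set: T] (fun w => \sum_(1 <= s < t) gamma ^+ (t - 1 - s)
    * (glm_loss m g tau (x s w) (r s w) (u s w)
       - mix_loss (gaussian_prob (theta s w) (alpha *: invmx (A s w)))
           (glm_loss m g tau (x s w) (r s w)))).
Proof.
move=> t1 mxru; under eq_fun do rewrite big_nat big_mkcond.
apply: measurable_sum => s.
have [s1t|_] := boolP (1 <= s < t)%N; last exact: measurable_cst.
have /andP[s1 st] := s1t; have [mx mr mu] := mxru s s1t.
have [mth mH] : measurable_fun [set: T] (theta s) /\ measurable_fun [set: T] (H s).
  apply: (measurable_omd cm hm g0 S0 lambda0 gamma01 eta0 homd s1) => i /andP[i1 ilt].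
  by have [] := mxru i; rewrite ?i1 ?(ltn_trans ilt st).
have mA := measurable_omd_A homd s1 mH.
apply: measurable_funM => //.
under eq_fun do rewrite covariance_precision//.
have mK : measurable_fun [set: T] (fun w => alpha^-1 *: A s w).
  exact: measurable_scalemx.
exact: (measurable_gap g tau hm mx mth mu mK mr (fun w => posdef_precision w s1)).
Qed.

End discounted_gap.

Theorem lemmaA2 (R : realType) (disp : measure_display)
  (Omega : measurableType disp) (P : probability Omega R)
  (d : nat) (hd : (1 <= d)%N) (Rmax S : R) (hRmax : 0 < Rmax) (hS : 0 < S)
  (m g : R -> R) (h : R -> R -> R) (tau : R)
  (nu : {measure set R -> \bar R})
  (hmconv : convex_function [set: convex_lmodType R^o] m) (hmC3 : C3 m)
  (hg : 0 < g tau)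
  (hh : measurable_fun [set: R] (fun r => h r tau))
  (hpdf : forall z, (\int[nu]_r (glm_pdf m g h tau z r)%:E = 1)%E)
  (X : nat -> Omega -> set 'cV[R]_d) (x : nat -> Omega -> 'cV[R]_d)
  (r : nat -> Omega -> R) (thetastar : nat -> Omega -> 'cV[R]_d)
  (hX : forall t w v, (1 <= t)%N -> X t w v -> norm2 v <= 1)
  (hxX : forall t w, (1 <= t)%N -> X t w (x t w))
  (hx : forall t, (1 <= t)%N -> measurable_fun [set: Omega] (x t))
  (hr : forall t, (1 <= t)%N -> measurable_fun [set: Omega] (r t))
  (hthetastar : forall t, (1 <= t)%N ->
    measurable_fun [set: Omega] (thetastar t))
  (hTheta : forall t w, (1 <= t)%N -> ball2 S (thetastar t w))
  (hrbound : forall t, (1 <= t)%N -> {ae P, forall w, 0 <= r t w <= Rmax})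
  (hlaw : forall t, (1 <= t)%N ->
    has_cond_density P (history x r thetastar t) (r t) nu
      (fun w => glm_pdf m g h tau (dotv (x t w) (thetastar t w))))
  (gamma delta lambda eta alpha : R)
  (hgamma : 0 < gamma < 1) (hdelta : 0 < delta < 1) (hlambda : 0 < lambda)
  (heta : eta = 1 + Rmax * S) (halpha : alpha = 3 * eta / 2)
  (theta1 : 'cV[R]_d) (htheta1 : ball2 S theta1)
  (theta : nat -> Omega -> 'cV[R]_d) (H A : nat -> Omega -> 'M[R]_d)
  (homd : forall w, discounted_omd S lambda gamma eta theta1
    (fun t => glm_loss m g tau (x t w) (r t w))
    (fun t => theta t w) (fun t => H t w) (fun t => A t w))
  (t : nat) (ht : (2 <= t)%N) :
  let loss s w := glm_loss m g tau (x s w) (r s w) in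
  let Pi s w := gaussian_prob (theta s w) (alpha *: invmx (A s w)) in
  let E := [set w | \sum_(1 <= s < t) gamma ^+ (t - 1 - s)
                      * (loss s w (thetastar s w)
                         - mix_loss (Pi s w) (loss s w))
                    <= ln (1 / delta)] in
  measurable E /\ ((1 - delta)%:E <= P E)%E.
Proof.
move=> loss Pi E.
have /andP[gamma0 gamma1] := hgamma; have /andP[delta0 delta1] := hdelta.
have eta0 : 0 < eta by rewrite heta ltr_pwDl// mulr_ge0// ltW.
have alpha0 : 0 < alpha by rewrite halpha divr_gt0// mulr_gt0.
have S0 : 0 <= S by exact: ltW.
have pp z y : 0 < glm_pdf m g h tau z y by exact: expR_gt0.
have nusf : sigma_finite setT nu.
  apply: (sigma_finite_of_pdf _ (pp 0)) (hpdf 0).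
  by apply: measurable_glm_pdf.
have [nuS nuE] := sigma_finite_bundle nusf.
have hpdf' z : (\int[nuS]_y (glm_pdf m g h tau z y)%:E = 1)%E.
  by rewrite -nuE; exact: hpdf.
have hlaw' s : (1 <= s)%N -> has_cond_density P (history x r thetastar s) (r s) nuS
    (fun w => glm_pdf m g h tau (dotv (x s w) (thetastar s w))).
  by move=> s1 C B GC mB; have := hlaw s s1 C B GC mB; rewrite nuE.
pose gap s w := loss s w (thetastar s w) - mix_loss (Pi s w) (loss s w).
pose W t w := \sum_(1 <= s < t) gamma ^+ (t - 1 - s) * gap s w.
have WS s w : (1 <= s)%N -> W s.+1 w = gamma * W s w + gap s w.
  move=> s1; rewrite /W big_nat_recr//= subn1 subnn expr0 mul1r; congr (_ + _).
  rewrite mulr_sumr !big_nat; apply: eq_bigr => i /andP[i1 ilt].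
  rewrite mulrA -exprS; congr (gamma ^+ _ * _).
  (* Subtraction on [nat] truncates; [i < s] is what makes [s - i] the successor of [s - 1 - i]. *)
  by rewrite subn1 -subSn ?prednK// -ltnS prednK.
have mW s : (1 <= s)%N -> measurable_fun [set: Omega] (W s).
  move=> s1; apply: (measurable_discounted_gap hmconv hmC3 hg S0 hlambda hgamma
    eta0 alpha0 homd s1) => i /andP[i1 _].
  by split; [exact: hx|exact: hr|exact: hthetastar].
pose G s := history_gen x r thetastar s.
(* [W s] involves only rounds before [s], so it is measurable for the history of round [s] and can
   play the part of [V] in [one_round_le]. *)
have GW s : (1 <= s)%N ->
    measurable_fun [set: g_sigma_algebraType (G s)] (W s : g_sigma_algebraType (G s) -> R).
  move=> s1; apply: (measurable_discounted_gap (T := g_sigma_algebraType (G s))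
    hmconv hmC3 hg S0 hlambda hgamma eta0 alpha0 homd s1) => i /andP[i1 ilt].
  split; [apply: measurable_history_x|apply: measurable_history_r
    |exact: measurable_history_u]; rewrite i1//= ltnW//.
have mexpW s : (1 <= s)%N -> measurable_fun [set: Omega] (fun w => expR (W s w)).
  by move=> s1; apply: (measurableT_comp (@measurable_expR R)); exact: mW.
have EW s : (1 <= s)%N -> (\int[P]_w (expR (W s w))%:E <= 1)%E.
  (* The base case is the empty sum [W 1 = 0]. *)
  elim: s => // -[_ _|s IH _].
    under eq_integral do rewrite /W big_geq// expR0.
    by rewrite integral_cst//= probability_setT mul1e.
  have s1 : (1 <= s.+1)%N by [].
  have [mth mH] : measurable_fun [set: g_sigma_algebraType (G s.+1)]
      (theta s.+1 : g_sigma_algebraType (G s.+1) -> _) /\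
      measurable_fun [set: g_sigma_algebraType (G s.+1)]
      (H s.+1 : g_sigma_algebraType (G s.+1) -> _).
    apply: (measurable_omd (T := g_sigma_algebraType (G s.+1)) hmconv hmC3 hg S0
      hlambda hgamma eta0 homd s1) => i /andP[i1 ilt].
    by split; [apply: measurable_history_x|apply: measurable_history_r];
      rewrite i1//= ltnW.
  have mA := measurable_omd_A (T := g_sigma_algebraType (G s.+1)) homd s1 mH.
  apply: (@le_trans _ _ (\int[P]_w (expR (gamma * W s.+1 w))%:E)%E).
    under eq_integral => w _.
      rewrite WS// /gap /Pi.
      rewrite (covariance_precision hmconv hmC3 hg hlambda hgamma alpha0 homd w s1).
      over.
    apply: (@one_round_le _ _ m g h tau nuS hmC3 hh hpdf' _ _ P (G s.+1) _ (r s.+1)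
      (x s.+1) (theta s.+1) (thetastar s.+1) (fun w => alpha^-1 *: A s.+1 w)
      (fun w => gamma * W s.+1 w)).
    - exact: history_sub_measurable.
    - exact: hr.
    - by apply: measurable_history_x; rewrite leqnn.
    - exact: mth.
    - exact: measurable_history_u.
    - exact: measurable_scalemx.
    - by apply: measurable_funM => //; exact: GW.
    - by move=> w; exact: (posdef_precision hmconv hmC3 hg hlambda hgamma alpha0 homd w s1).
    - exact: hlaw'.
  apply: (@le_trans _ _ (\int[P]_w ((gamma%:E * (expR (W s.+1 w))%:E) + (1 - gamma)%:E))%E).
    apply: ge0_le_integral.
    - exact: measurableT.
    - by move=> w _; rewrite lee_fin expR_ge0.
    - apply/measurable_EFinP; apply: (measurableT_comp (@measurable_expR R)).
      by apply: measurable_funM => //; exact: mW.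
    - apply: emeasurable_funD => //; apply: emeasurable_funM => //.
      by apply/measurable_EFinP; exact: mexpW.
    - move=> w _; rewrite -EFinM -EFinD lee_fin.
      have h01 : 0 <= gamma <= 1 by rewrite !ltW.
      (* Convexity between the points [W] and 0, with weights [gamma] and [1 - gamma]; the value
         [expR 0 = 1] supplies the constant term. *)
      have := @convex_expR R (Itv01 (proj1 (andP h01)) (proj2 (andP h01))) (W s.+1 w) 0.
      by rewrite !convRE /= expR0 mulr0 addr0 mulr1.
  rewrite ge0_integralD//; last 3 first.
  - by move=> w _; rewrite mule_ge0 ?lee_fin ?expR_ge0 ?ltW.
  - apply: emeasurable_funM => //.
    by apply/measurable_EFinP; exact: mexpW.
  - by move=> w _; rewrite lee_fin subr_ge0 ltW.
  rewrite integral_cst//= probability_setT mule1 ge0_integralZl//; last 2 first.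
  - by apply/measurable_EFinP; exact: mexpW.
  - by rewrite lee_fin ltW.
  (* The bound reproduces itself because 1 is the fixed point of [a -> gamma a + 1 - gamma]. *)
  rewrite (@le_trans _ _ (gamma%:E * 1 + (1 - gamma)%:E)%E)//.
    by apply: leeD2r; apply: lee_wpmul2l; [rewrite lee_fin ltW|exact: IH].
  by rewrite mule1 -EFinD addrC subrK.
have t1 : (1 <= t)%N by exact: ltnW.
have mE : measurable E.
  rewrite (_ : E = W t @^-1` `]-oo, ln (1 / delta)]); last first.
    by apply/seteqP; split => w /=; rewrite in_itv.
  by rewrite -[X in measurable X]setTI; apply: mW => //; exact: measurable_itv.
split => //.
have d0 : 0 < 1 / delta by rewrite divr_gt0.
have mexp := mexpW t t1.
have mB : measurable [set w | 1 / delta <= expR (W t w)].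
  rewrite -[X in measurable X]setTI -preimage_itvcy.
  by apply: mexp => //; exact: measurable_itv.
have := le_trans (mul_measure_ge_le_integral P mexp (fun w => expR_ge0 _) d0) (EW t t1).
(* Off [E] the sum exceeds [ln (1 / delta)], so its exponential reaches the Markov threshold
   [1 / delta]. *)
have PC : (P (~` E) <= P [set w | (1 / delta <= expR (W t w))%R])%E.
  apply: le_measure; rewrite ?inE//; first exact: measurableC.
  move=> w /= /negP; rewrite -ltNge => lw.
  by rewrite -[leLHS](lnK (x := 1 / delta)) ?posrE// ler_expR ltW.
move=> /(lee_wpmul2l (_ : 0 <= delta%:E)%E) Pd.
have PE : (P (~` E) <= delta%:E)%E.
  apply: (le_trans PC); move: Pd; rewrite lee_fin ltW// => /(_ isT).
  by rewrite muleA -EFinM mule1 mulrCA divff ?gt_eqF// mulr1 mul1e.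
move: PE; rewrite probability_setC//.
rewrite -(fineK (fin_num_measure P _ mE)) -EFinB !lee_fin lerBlDr addrC.
by rewrite -lerBlDr.
Qed.
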